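(* Consider the elliptical factor model and the estimator $\widehat{E(\xi_t^2)}$ described in the context, and suppose that Assumptions 1, 2 and 3 (stated in the context, with $\varepsilon\in(0,2)$ the moment index of Assumption 1) hold. If in addition $n\to\infty$ and $\log p=O(n)$, then $$\big|\widehat{E(\xi_t^2)}-E(\xi_t^2)\big|=O_p\Big(\frac{1}{n^{\varepsilon/(2+\varepsilon)}}+\sqrt{\frac{\log p}{n}}\Big).$$
   Context: Notation: $\|\cdot\|_2$ is the Euclidean norm of a vector. Model: one observes $\mathbf{y}_1,\dots,\mathbf{y}_n\in\mathbb{R}^p$ with $\mathbf{y}_t=\boldsymbol{\mu}+\sqrt{p}\,\xi_t\boldsymbol{\Sigma}_0^{1/2}\mathbf{u}_t$, where $\boldsymbol{\mu}\in\mathbb{R}^p$ is deterministic, $\boldsymbol{\Sigma}_0$ (the scatter matrix) is a deterministic $p\times p$ nonnegative definite matrix normalized so that $\operatorname{tr}(\boldsymbol{\Sigma}_0)=p$, $\xi_t\ge 0$ is a scalar random variable, and the $\mathbf{u}_t$ are i.i.d. uniform on the unit sphere of $\mathbb{R}^p$; equivalently $\mathbf{u}_t=\mathbf{z}_t/\|\mathbf{z}_t\|_2$ with $\mathbf{z}_t$ i.i.d. $N(0,\mathbf{I}_p)$. All asymptotics are with $p=p_n$; constants below do not depend on $n,p$. Assumption 1: $(\xi_t)$ are i.i.d. and independent of $(\mathbf{u}_t)$; there are constants $0<c<C<\infty$ with $E(\xi_t^{2+\varepsilon})<C$ for some $0<\varepsilon<2$ and $P(|\xi_t|>c)=1$.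 Assumption 2: there are constants $0<c<C<\infty$ with $c<\min_{1\le i\le p}(\boldsymbol{\Sigma}_0)_{ii}\le\max_{1\le i\le p}(\boldsymbol{\Sigma}_0)_{ii}<C$. Let $\lambda_{0;1}\ge\dots\ge\lambda_{0;p}$ be the eigenvalues of $\boldsymbol{\Sigma}_0$. Assumption 3: there exist $K\in\mathbb{N}$ and $\delta>0$ such that $\delta p\le\lambda_{0;i}\le p/\delta$ for $i=1,\dots,K$, and $0<\delta\le\lambda_{0;i}\le 1/\delta$ for $i=K+1,\dots,p$. Estimators. Huber function: $\Psi_H(x)=\min(H,\max(-H,x))$. The estimator $\widehat{\boldsymbol{\mu}}=(\widehat\mu_i)_{1\le i\le p}$ solves $\sum_{t=1}^n\Psi_H(y_{i,t}-\widehat\mu_i)=0$ for each $i$, where $y_{i,t}$ is the $i$th entry of $\mathbf{y}_t$ and the tuning parameter $H$ goes to infinity with $n$ and satisfies $H=O(\sqrt{n/\log p})$. The estimator $\widehat{E(\xi_t^2)}$ is a solution of $\sum_{t=1}^n\Psi_{H'}\big(\|\mathbf{y}_t-\widehat{\boldsymbol{\mu}}\|_2^2/p-\widehat{E(\xi_t^2)}\big)=0$ with tuning parameter $H'\asymp n^{1/(1+\varepsilon/2)}$. *)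

(* Defs.v *)
From HB Require Import structures.
From mathcomp Require Import all_boot all_order all_algebra.
From mathcomp Require Import all_classical all_reals all_analysis.
Import Order.TTheory GRing.Theory Num.Theory.
Import numFieldNormedType.Exports.

Set Implicit Arguments.
Unset Strict Implicit.
Unset Printing Implicit Defensive.

Local Open Scope classical_set_scope.
Local Open Scope ring_scope.

Section LinearAlgebra.
Context {R : realType}.

(* The library norm on matrices is the sup norm, hence this definition. *)
Definition norm2 (k : nat) (v : 'cV[R]_k) : R :=
  Num.sqrt (\sum_(i < k) v i ord0 ^+ 2).

Definition psd (k : nat) (A : 'M[R]_k) : Prop :=
  A^T = A /\ forall x : 'cV[R]_k, 0 <= (x^T *m A *m x) ord0 ord0.

(* The square root of a nonnegative definite matrix exists and is unique. *)
Definition psd_sqrt_of (k : nat) (A S : 'M[R]_k) : Prop :=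
  psd S /\ S *m S = A.

(* lam lists the eigenvalues of A, with multiplicity, in nonincreasing order;
   it is 0-based: lam i is the (i + 1)-st largest eigenvalue. *)
Definition ordered_eigenvalues (k : nat) (A : 'M[R]_k) (lam : 'I_k -> R)
    : Prop :=
  (forall i j : 'I_k, (i <= j)%N -> lam j <= lam i) /\
  char_poly A = \prod_(i < k) ('X - (lam i)%:P).

Definition huber (H x : R) : R := Num.min H (Num.max (- H) x).

End LinearAlgebra.

Section Probability.
Context {d : measure_display} {T : measurableType d} {R : realType}.
Variable P : probability T R.

(* Subfamilies are covered by taking A i = setT off the subfamily. *)
Definition mutually_independent (I : finType) (X : I -> T -> R) : Prop :=
  forall A : I -> set R, (forall i, measurable (A i)) ->
    P (\bigcap_(i in setT) (X i @^-1` A i)) =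
    (\prod_(i : I) P (X i @^-1` A i))%E.

Definition identically_distributed (I : finType) (X : I -> {RV P >-> R})
    : Prop :=
  forall (i j : I) (A : set R), measurable A ->
    distribution P (X i) A = distribution P (X j) A.

Definition sigma_of (I : finType) (X : I -> T -> R) : set (set T) :=
  <<s \bigcup_(i in setT) preimage_set_system setT (X i) measurable >>.

Definition independent_families (I J : finType) (X : I -> T -> R)
    (Y : J -> T -> R) : Prop :=
  forall E F : set T, sigma_of X E -> sigma_of Y F ->
    P (E `&` F) = (P E * P F)%E.

Definition standard_normal (X : {RV P >-> R}) : Prop :=
  forall A : set R, measurable A -> distribution P X A = normal_prob 0 1 A.

(* The coordinates of k i.i.d. N(0, I_q) vectors. *)
Definition iid_standard_gaussian_vectors (k q : nat)
    (z : 'I_k -> 'I_q -> {RV P >-> R}) : Prop :=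
  mutually_independent (fun ti : 'I_k * 'I_q => z ti.1 ti.2 : T -> R) /\
  forall t i, standard_normal (z t i).

(* z / ||z||_2, which is uniform on the unit sphere for z ~ N(0, I_q);
   it takes the value 0 on the null event z = 0. *)
Definition direction (q : nat) (z : 'I_q -> {RV P >-> R}) (w : T) : 'cV[R]_q :=
  let v := \col_i z i w in (norm2 v)^-1 *: v.

Definition elliptical_obs (q : nat) (mu : 'cV[R]_q) (S : 'M[R]_q)
    (xi : {RV P >-> R}) (z : 'I_q -> {RV P >-> R}) (w : T) : 'cV[R]_q :=
  mu + (Num.sqrt q%:R * xi w) *: (S *m direction z w).

End Probability.

(* A triangular array: for each sample size n there are a probability space
   (T n, P n), a dimension p n and a sample indexed by 'I_n. *)
Section Array.
Context {R : realType} {d : nat -> measure_display}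
  {T : forall n, measurableType (d n)}.
Variables (P : forall n, probability (T n) R) (p : nat -> nat).

Definition assumption1 (eps : R) (xi : forall n, 'I_n -> {RV (P n) >-> R})
    (u : forall n, 'I_n -> T n -> 'cV[R]_(p n)) : Prop :=
  [/\ forall n, mutually_independent (P n) (fun t => xi n t : T n -> R),
      forall n, identically_distributed (xi n),
      forall n, independent_families (P n) (fun t => xi n t : T n -> R)
        (fun (ti : 'I_n * 'I_(p n)) w => u n ti.1 w ti.2 ord0)
    & exists c C : R, 0 < c < C /\ forall n (t : 'I_n),
        ('E_(P n)[(fun w => xi n t w `^ (2 + eps))%R] < C%:E)%E /\
        P n [set w | (c < `|xi n t w|)%R] = 1%E].

Definition assumption2 (Sigma : forall n, 'M[R]_(p n)) : Prop :=
  exists c C : R, 0 < c < C /\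
    forall n (i : 'I_(p n)), c < Sigma n i i < C.

Definition assumption3 (lam : forall n, 'I_(p n) -> R) : Prop :=
  exists (K : nat) (delta : R), 0 < delta /\
    forall n (i : 'I_(p n)),
      if (i < K)%N
      then delta * (p n)%:R <= lam n i <= (p n)%:R / delta
      else delta <= lam n i <= delta^-1.

(* X n = O_p(r n) as n -> oo. *)
Definition bigO_p (X : forall n, T n -> R) (r : nat -> R) : Prop :=
  forall eta : R, 0 < eta -> exists2 M : R, 0 < M &
    \forall n \near \oo,
      (P n [set w | (M * r n < `|X n w|)%R] <= eta%:E)%E.

End Array.

(* Main.v *)
Require Import Defs.
From HB Require Import structures.
From mathcomp Require Import all_boot all_order fingroup perm all_algebra.
From mathcomp Require Import all_classical all_reals all_analysis.
From mathcomp Require Import measurable_realfun ring lra.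
Import Order.TTheory GRing.Theory Num.Theory.
Import numFieldNormedType.Exports.
Set Implicit Arguments.
Unset Strict Implicit.
Unset Printing Implicit Defensive.
Local Open Scope classical_set_scope.
Local Open Scope ring_scope.

(** Why the estimate holds.

    Write [theta] for the common mean of the [xi ^+ 2] and [q] for the
    dimension. At the true centre the rescaled squared norm of an observation is
    [xi ^+ 2 * quad u] with [quad u] the quadratic form of the scatter matrix at
    the uniform direction [u]; its mean is [theta] because the trace of the
    matrix is [q]. These variables are independent over the sample and have a
    bounded moment of order [1 + eps / 2], since [quad u] is bounded in mean
    square in terms of the trace ([mean_quad_sqr], [mean_energy_powR]). For such
    variables the Huber score at [theta] with threshold [H'] has a bias of order
    [H' ^ (- eps / 2)] and a variance of order [H' ^ (1 - eps / 2) / n]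
    ([huber_score_mse]); for [H'] of order [n ^ (1 / (1 + eps / 2))] both give
    the rate [rho = n ^ (- eps / (2 + eps))] ([score_rate]).

    The location estimate enters through [V], the root mean square over the
    coordinates of its error. Replacing the true centre by the estimate changes
    each squared norm by at most [V * (1 + energy) + V ^+ 2], and the score is
    1-Lipschitz, so the estimate of [theta] moves by a multiple of [V]
    ([scale_error_le]). Each coordinate of an observation is centred symmetric
    with bounded variance, so its Huber score has mean zero
    ([mean_odd_scaled_dot]), and [huber_location_mse] bounds the mean squared
    error of the corresponding coordinate of the estimate by a multiple of
    [1 / n], uniformly over the coordinates. Averaging over the coordinates, [V]
    is of order [n ^ (- 1 / 2)] in probability, which is at most [rho] because
    [eps < 2].

    Passing from the score to the root of a Huber equation is deterministic
    ([huber_root_near], [huber_root_far]): as long as the mean absolute deviation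
    is at most [H / 8], most observations stay in the linear part and the
    root is at most twice the mean score; otherwise the root is at most
    [2 * H] plus four times that mean.

    The moments of [u] come from the symmetries of a standard Gaussian vector,
    whose law is determined by its values on boxes ([gaussian_vec_law]). Sign
    flips kill the mixed second moments and the odd terms of a fourth power
    ([pow4_sum_le]), permutations equate the coordinates, and Chebyshev's
    inequality for the squared norm gives fourth moments of order [1 / q ^ 2]
    ([mean_dir_pow4], [mean_dot_pow4]). *)

(** * Integrable functions on a probability space *)

Section Expectation.
Context {d : measure_display} {T : measurableType d} {R : realType}.
Variable P : probability T R.
Implicit Types (f g : T -> R) (c : R).

Definition L1 f : Prop := P.-integrable setT (EFin \o f).

Definition mean f : R := \int[P]_w f w.

Lemma L1_measurable f : L1 f -> measurable_fun setT f.
Proof. by move=> /measurable_int /measurable_EFinP. Qed.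

Lemma mean_EFin f : L1 f -> (\int[P]_w (f w)%:E)%E = (mean f)%:E.
Proof. by move=> f1; rewrite /mean /Rintegral fineK// integrable_fin_num. Qed.

Lemma L1_le f g : measurable_fun setT f -> (forall w, `|f w| <= g w) ->
  L1 g -> L1 f.
Proof.
move=> mf fg; apply: le_integrable => //; first exact/measurable_EFinP.
by move=> w _ /=; rewrite lee_fin (le_trans (fg w))// ler_norm.
Qed.

Lemma L1_cst c : L1 (fun=> c).
Proof. exact: finite_measure_integrable_cst. Qed.

Lemma L1_bounded f c : measurable_fun setT f -> (forall w, `|f w| <= c) -> L1 f.
Proof. by move=> mf fc; apply: (L1_le mf fc); exact: L1_cst. Qed.

Lemma L1D f g : L1 f -> L1 g -> L1 (fun w => f w + g w).
Proof. exact: integrableD. Qed.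

Lemma L1B f g : L1 f -> L1 g -> L1 (fun w => f w - g w).
Proof. exact: integrableB. Qed.

Lemma L1Z c f : L1 f -> L1 (fun w => c * f w).
Proof. exact: integrableZl. Qed.

Lemma L1_sum (I : Type) (s : seq I) (F : I -> T -> R) :
  (forall i, L1 (F i)) -> L1 (fun w => \sum_(i <- s) F i w).
Proof.
move=> F1; elim: s => [|i s IH].
  by under [fun _ => _]funext do rewrite big_nil; exact: L1_cst.
by under [fun _ => _]funext do rewrite big_cons; exact: L1D.
Qed.

Lemma L1_norm f : L1 f -> L1 (fun w => `|f w|).
Proof. exact: integrable_norm. Qed.

Lemma L1_mul f g : measurable_fun setT f -> measurable_fun setT g ->
  L1 (fun w => f w ^+ 2) -> L1 (fun w => g w ^+ 2) -> L1 (fun w => f w * g w).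
Proof.
move=> mf mg f2 g2; apply: L1_le (L1D f2 g2); first exact: measurable_funM.
move=> w; rewrite normrM -(real_normK (num_real (f w))).
by rewrite -(real_normK (num_real (g w))); nra.
Qed.

Lemma L1_of_sqr f : measurable_fun setT f -> L1 (fun w => f w ^+ 2) -> L1 f.
Proof.
move=> mf f2; apply: (L1_le mf _ (L1D f2 (L1_cst 1))) => w.
by rewrite -(real_normK (num_real (f w))); nra.
Qed.

Lemma L1_sqrD f g : measurable_fun setT f -> measurable_fun setT g ->
  L1 (fun w => f w ^+ 2) -> L1 (fun w => g w ^+ 2) ->
  L1 (fun w => (f w + g w) ^+ 2).
Proof.
move=> mf mg f2 g2.
apply: (L1_le _ _ (L1Z 2 (L1D f2 g2))).
  by apply: measurable_funX; exact: measurable_funD.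
move=> w; rewrite ger0_norm ?sqr_ge0//.
by have := sqr_ge0 (f w - g w); nra.
Qed.

Lemma mean_cst c : mean (fun=> c) = c.
Proof. by rewrite /mean Rintegral_cst//= [X in fine X]probability_setT mulr1. Qed.

Lemma meanD f g : L1 f -> L1 g -> mean (fun w => f w + g w) = mean f + mean g.
Proof. by move=> f1 g1; rewrite /mean RintegralD. Qed.

Lemma meanB f g : L1 f -> L1 g -> mean (fun w => f w - g w) = mean f - mean g.
Proof. by move=> f1 g1; rewrite /mean RintegralB. Qed.

Lemma meanZ c f : L1 f -> mean (fun w => c * f w) = c * mean f.
Proof. by move=> f1; rewrite /mean RintegralZl. Qed.

Lemma mean_sum (I : Type) (s : seq I) (F : I -> T -> R) :
  (forall i, L1 (F i)) ->
  mean (fun w => \sum_(i <- s) F i w) = \sum_(i <- s) mean (F i).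
Proof.
move=> F1; elim: s => [|i s IH].
  by under [fun _ => _]funext do rewrite big_nil; rewrite mean_cst big_nil.
under [fun _ => _]funext do rewrite big_cons.
by rewrite meanD// ?IH ?big_cons//; exact: L1_sum.
Qed.

Lemma mean_le f g : L1 f -> L1 g -> (forall w, f w <= g w) -> mean f <= mean g.
Proof. by move=> f1 g1 fg; apply: le_Rintegral. Qed.

Lemma mean_ge0 f : (forall w, 0 <= f w) -> 0 <= mean f.
Proof. by move=> f0; apply: Rintegral_ge0. Qed.

Lemma mean_indic (A : set T) : measurable A -> (mean (\1_A))%:E = P A.
Proof.
move=> mA; rewrite -mean_EFin; last exact: integrable_indic.
by rewrite integral_indic// setIT.
Qed.

Lemma norm_mean_le f : L1 f -> `|mean f| <= mean (fun w => `|f w|).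
Proof. exact: le_normr_Rintegral. Qed.

Lemma markov_L1 f c : 0 < c -> (forall w, 0 <= f w) -> L1 f ->
  (P [set w | (c < f w)%R] <= (mean f / c)%:E)%E.
Proof.
move=> c0 f0 f1; have mf := L1_measurable f1.
have mA : measurable [set w | c < f w].
  by rewrite -[X in measurable X]setTI; exact: measurable_fun_ltr.
rewrite -(mean_indic mA) lee_fin ler_pdivlMr// mulrC -meanZ.
  apply: mean_le => //; first by apply: L1Z; exact: integrable_indic.
  move=> w; rewrite indicE; case: (boolP (w \in _)) => [|_].
    by rewrite inE /= mulr1 => /ltW.
  by rewrite mulr0.
exact: integrable_indic.
Qed.

Lemma L1_of_ge0 f : measurable_fun setT f -> (forall w, 0 <= f w) ->
  (\int[P]_w (f w)%:E < +oo)%E -> L1 f.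
Proof.
move=> mf f0 foo; apply/integrableP; split; first exact/measurable_EFinP.
by rewrite (eq_integral (fun w => (f w)%:E))// => w _ /=; rewrite ger0_norm.
Qed.

End Expectation.

(** * Independence *)

Section Independence.
Context {d : measure_display} {T : measurableType d} {R : realType}.
Variable P : probability T R.
Implicit Types (F G : set (set T)) (X Y : T -> R).

Definition indep_systems F G : Prop :=
  forall A B, F A -> G B -> P (A `&` B) = (P A * P B)%E.

Lemma indep_systemsC F G : indep_systems F G -> indep_systems G F.
Proof. by move=> FG A B GA FB; rewrite setIC FG// muleC. Qed.

(** For a fixed [B], both [P (A `&` B)] and [P A * P B] are finite measures in
    [A]; they agree on a pi-system, hence on the sigma-algebra it generates. *)
Lemma indep_systems_sigmal F G : F `<=` measurable -> G `<=` measurable ->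
  F setT -> setI_closed F -> indep_systems F G -> indep_systems <<s F >> G.
Proof.
move=> mF mG FT FI FG A B sFA GB; have mB := mG _ GB.
have pB0 : 0 <= fine (P B) by rewrite fine_ge0.
pose m1 := mrestr P mB.
pose m2 := mscale (NngNum pB0) P.
have -> : P (A `&` B) = m1 A by [].
have m2E C : m2 C = (P C * P B)%E.
  by rewrite muleC -[X in (_ = X * _)%E]fineK// fin_num_measure.
rewrite -m2E.
apply: (g_sigma_algebra_measure_unique F _ (fun=> setT)) => //.
- by rewrite bigcup_const//; exists 0%N.
- by move=> C FC; rewrite [RHS]m2E; exact: FG.
- by move=> _; rewrite /m1 /= /mrestr setTI ltey_eq fin_num_measure.
Qed.

Lemma indep_systems_sigma F G : F `<=` measurable -> G `<=` measurable ->
  F setT -> setI_closed F -> G setT -> setI_closed G ->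
  indep_systems F G -> indep_systems <<s F >> <<s G >>.
Proof.
move=> mF mG FT FI GT GI FG.
apply: indep_systems_sigmal => //.
  exact: (smallest_sub (sigma_algebra_measurable _)).
apply: indep_systemsC; apply: indep_systems_sigmal => //.
exact: indep_systemsC.
Qed.

Definition indep_rv {d1 d2} {T1 : measurableType d1} {T2 : measurableType d2}
    (X : T -> T1) (Y : T -> T2) : Prop := forall A B,
  measurable A -> measurable B ->
  P (X @^-1` A `&` Y @^-1` B) = (P (X @^-1` A) * P (Y @^-1` B))%E.

Lemma indep_rv_comp {d1 d2 d3 d4} {T1 : measurableType d1}
    {T2 : measurableType d2} {T3 : measurableType d3} {T4 : measurableType d4}
    (f : T1 -> T3) (g : T2 -> T4) (X : T -> T1) (Y : T -> T2) :
  measurable_fun setT f -> measurable_fun setT g -> indep_rv X Y ->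
  indep_rv (f \o X) (g \o Y).
Proof.
move=> mf mg XY A B mA mB.
apply: (XY (f @^-1` A) (g @^-1` B)).
  by rewrite -[X in measurable X]setTI; exact: mf.
by rewrite -[X in measurable X]setTI; exact: mg.
Qed.

Lemma indep_rv_pi {d1 d2} {T1 : measurableType d1} {T2 : measurableType d2}
    (G1 : set (set T1)) (G2 : set (set T2)) (X : T -> T1) (Y : T -> T2) :
  measurable_fun setT X -> measurable_fun setT Y ->
  measurable `<=` <<s G1 >> -> G1 `<=` measurable -> G1 setT -> setI_closed G1 ->
  measurable `<=` <<s G2 >> -> G2 `<=` measurable -> G2 setT -> setI_closed G2 ->
  (forall A B, G1 A -> G2 B ->
    P (X @^-1` A `&` Y @^-1` B) = (P (X @^-1` A) * P (Y @^-1` B))%E) ->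
  indep_rv X Y.
Proof.
move=> mX mY sG1 mG1 G1T G1I sG2 mG2 G2T G2I XY A B mA mB.
have preE d' (T' : measurableType d') (Z : T -> T') (G : set (set T')) C :
    measurable `<=` <<s G >> -> measurable C ->
    <<s preimage_set_system setT Z G >> (Z @^-1` C).
  move=> sG mC; rewrite g_sigma_preimageE; exists C; last by rewrite setTI.
  exact: sG.
have preI (T' : Type) (Z : T -> T') (G : set (set T')) : setI_closed G ->
    setI_closed (preimage_set_system setT Z G).
  move=> GI _ _ [C GC <-] [D GD <-]; exists (C `&` D); first exact: GI.
  by rewrite !setTI.
have pre_meas d' (T' : measurableType d') (Z : T -> T') (G : set (set T')) :
    measurable_fun setT Z -> G `<=` measurable ->
    preimage_set_system setT Z G `<=` measurable.
  by move=> mZ mG _ [C GC <-]; apply: mZ => //; exact: mG.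
apply: (indep_systems_sigma (pre_meas _ _ X _ mX mG1) (pre_meas _ _ Y _ mY mG2)
  _ (preI _ X _ G1I) _ (preI _ Y _ G2I) _ (preE _ _ X _ _ sG1 mA)
  (preE _ _ Y _ _ sG2 mB)).
- by exists setT; rewrite // preimage_setT setTI.
- by exists setT; rewrite // preimage_setT setTI.
- by move=> _ _ [C GC <-] [D GD <-]; rewrite !setTI; exact: XY.
Qed.

(** Rectangles generate the product sigma-algebra, and a rectangle event for
    the pairs is an event for the [X]'s intersected with one for the [Y]'s. *)
Lemma indep_rv_pairs {d1 d2} {T1 : measurableType d1} {T2 : measurableType d2}
    (X1 X2 : T -> T1) (Y1 Y2 : T -> T2) :
  measurable_fun setT X1 -> measurable_fun setT X2 ->
  measurable_fun setT Y1 -> measurable_fun setT Y2 ->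
  indep_rv X1 X2 -> indep_rv Y1 Y2 ->
  (forall A1 A2 B1 B2, measurable A1 -> measurable A2 -> measurable B1 ->
    measurable B2 ->
    P ((X1 @^-1` A1 `&` X2 @^-1` A2) `&` (Y1 @^-1` B1 `&` Y2 @^-1` B2)) =
    (P (X1 @^-1` A1 `&` X2 @^-1` A2) * P (Y1 @^-1` B1 `&` Y2 @^-1` B2))%E) ->
  indep_rv (fun w => (X1 w, Y1 w)) (fun w => (X2 w, Y2 w)).
Proof.
move=> mX1 mX2 mY1 mY2 X12 Y12 XY.
have XY1 A B : measurable A -> measurable B ->
    P (X1 @^-1` A `&` Y1 @^-1` B) = (P (X1 @^-1` A) * P (Y1 @^-1` B))%E.
  move=> mA mB; have := XY A setT B setT mA measurableT mB measurableT.
  by rewrite !preimage_setT !setIT.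
have XY2 A B : measurable A -> measurable B ->
    P (X2 @^-1` A `&` Y2 @^-1` B) = (P (X2 @^-1` A) * P (Y2 @^-1` B))%E.
  move=> mA mB; have := XY setT A setT B measurableT mA measurableT mB.
  by rewrite !preimage_setT !setTI.
pose rect := [set C : set (T1 * T2) | exists2 A, measurable A &
  exists2 B, measurable B & A `*` B = C].
have rect_meas : rect `<=` measurable.
  by move=> _ [A mA [B mB <-]]; exact: measurableX.
have rectT : rect setT.
  by exists setT => //; exists setT => //; rewrite setXTT.
have rectI : setI_closed rect.
  move=> _ _ [A mA [B mB <-]] [A' mA' [B' mB' <-]]; rewrite -setXI.
  by exists (A `&` A'); [exact: measurableI|exists (B `&` B');
    [exact: measurableI|]].
have sub_rect : @measurable _ (T1 * T2)%type `<=` <<s rect >>.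
  by rewrite measurable_prod_measurableType.
apply: (indep_rv_pi _ _ sub_rect rect_meas rectT rectI sub_rect rect_meas rectT rectI).
- exact: measurable_fun_pair.
- exact: measurable_fun_pair.
move=> _ _ [A1 mA1 [B1 mB1 <-]] [A2 mA2 [B2 mB2 <-]].
have preX (X : T -> T1) (Y : T -> T2) A B :
  (fun w => (X w, Y w)) @^-1` (A `*` B) = X @^-1` A `&` Y @^-1` B by [].
rewrite !preX setIACA XY// X12// Y12// XY1// XY2//.
by rewrite muleACA.
Qed.

Section product_law.
Variables X Y : T -> R.
Hypotheses (mX : measurable_fun setT X) (mY : measurable_fun setT Y).
Hypothesis XY : indep_rv X Y.

Let X' : {mfun T >-> R} := mfun_Sub (mem_set mX).
Let Y' : {mfun T >-> R} := mfun_Sub (mem_set mY).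
Let mXY : measurable_fun setT (fun w => (X w, Y w)).
Proof. exact: measurable_fun_pair. Qed.
Let XY' : {mfun T >-> (R * R)%type} := mfun_Sub (mem_set mXY).

Let law_pair A : measurable A ->
  distribution P XY' A = (distribution P X' \x distribution P Y')%E A.
Proof.
move=> mA; apply/esym.
exact: (@product_measure_unique _ _ _ _ _ (distribution P X')
  (distribution P Y') (distribution P XY')).
Qed.

(** The law of an independent pair is the product of the marginal laws, so
    Tonelli's theorem applies. *)
Lemma integral_pair_ge0 (f : R * R -> R) : measurable_fun setT f ->
  (forall z, 0 <= f z) ->
  (\int[P]_w (f (X w, Y w))%:E = \int[P]_v \int[P]_w (f (X v, Y w))%:E)%E.
Proof.
move=> mf f0.
have mf' : measurable_fun setT (EFin \o f) by exact/measurable_EFinP.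
have -> : (\int[P]_w (f (X w, Y w))%:E =
  \int[distribution P XY']_z (EFin \o f) z)%E.
  by rewrite ge0_integral_distribution// => z; rewrite lee_fin.
rewrite (eq_measure_integral (distribution P X' \x distribution P Y')%E);
  last by move=> A mA _; exact: law_pair.
rewrite fubini_tonelli1//.
rewrite ge0_integral_distribution//.
- apply: eq_integral => v _ /=; rewrite /fubini_F ge0_integral_distribution//.
    exact: measurableT_comp mf' (pair1_measurable _).
  by move=> y; rewrite lee_fin.
- exact: measurable_fun_fubini_tonelli_F.
- by move=> v; apply: integral_ge0 => y _; rewrite lee_fin.
Qed.

End product_law.

Lemma mean_mul_ge0 X Y : L1 P X -> L1 P Y -> (forall w, 0 <= X w) ->
  (forall w, 0 <= Y w) -> indep_rv X Y ->
  L1 P (fun w => X w * Y w) /\ mean P (fun w => X w * Y w) = mean P X * mean P Y.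
Proof.
move=> X1 Y1 X0 Y0 XY.
have mX := L1_measurable X1; have mY := L1_measurable Y1.
have H : (\int[P]_w (X w * Y w)%:E = (mean P X * mean P Y)%:E)%E.
  transitivity (\int[P]_w (`|X w| * `|Y w|)%:E)%E.
    by apply: eq_integral => w _; rewrite !ger0_norm.
  rewrite (integral_pair_ge0 mX mY XY (f := fun z => `|z.1| * `|z.2|));
    [| |by move=> z; exact: mulr_ge0].
    rewrite (eq_integral (fun v => (mean P Y * X v)%:E)).
      by rewrite (mean_EFin (L1Z _ X1)) meanZ// mulrC.
    move=> v _; rewrite (eq_integral (fun w => (X v * Y w)%:E)).
      by rewrite (mean_EFin (L1Z _ Y1)) meanZ// mulrC.
    by move=> w _; rewrite /= !ger0_norm.
  by apply: measurable_funM; exact: measurableT_comp.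
split; last by rewrite {1}/mean /Rintegral H.
apply: L1_of_ge0; [exact: measurable_funM|by move=> w; exact: mulr_ge0|].
by rewrite H ltry.
Qed.

(** The nonnegative case applies to each product of a positive or negative part
    of [X] with one of [Y]. *)
Lemma mean_mul X Y : L1 P X -> L1 P Y -> indep_rv X Y ->
  L1 P (fun w => X w * Y w) /\ mean P (fun w => X w * Y w) = mean P X * mean P Y.
Proof.
pose pos (x : R) := Num.max x 0; pose neg (x : R) := Num.max (- x) 0.
have mpos : measurable_fun setT pos by exact: measurable_maxr.
have mneg : measurable_fun setT neg.
  by apply: measurable_maxr => //; exact: oppr_measurable.
have pos0 x : 0 <= pos x by rewrite le_max lexx orbT.
have neg0 x : 0 <= neg x by rewrite le_max lexx orbT.
have posneg x : x = pos x - neg x.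
  by rewrite /pos /neg /Num.max; case: ifP; case: ifP; lra.
have L1pos Z : L1 P Z -> L1 P (pos \o Z).
  move=> Z1; apply: (L1_le _ _ (L1_norm Z1)).
    exact: measurableT_comp (L1_measurable Z1).
  move=> w; rewrite ger0_norm//= ge_max normr_ge0 ler_norm//.
have L1neg Z : L1 P Z -> L1 P (neg \o Z).
  move=> Z1; apply: (L1_le _ _ (L1_norm Z1)).
    exact: measurableT_comp (L1_measurable Z1).
  by move=> w; rewrite ger0_norm//= ge_max normr_ge0 -normrN ler_norm.
move=> X1 Y1 XY.
have [ppL pp] := mean_mul_ge0 (L1pos _ X1) (L1pos _ Y1) (fun w => pos0 _)
  (fun w => pos0 _) (indep_rv_comp mpos mpos XY).
have [pnL pn] := mean_mul_ge0 (L1pos _ X1) (L1neg _ Y1) (fun w => pos0 _)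
  (fun w => neg0 _) (indep_rv_comp mpos mneg XY).
have [npL np] := mean_mul_ge0 (L1neg _ X1) (L1pos _ Y1) (fun w => neg0 _)
  (fun w => pos0 _) (indep_rv_comp mneg mpos XY).
have [nnL nn] := mean_mul_ge0 (L1neg _ X1) (L1neg _ Y1) (fun w => neg0 _)
  (fun w => neg0 _) (indep_rv_comp mneg mneg XY).
have mE Z : L1 P Z -> mean P Z = mean P (pos \o Z) - mean P (neg \o Z).
  move=> Z1; rewrite -meanB; [|exact: L1pos|exact: L1neg].
  by congr mean; apply/funext => w; rewrite /= -posneg.
have -> : (fun w => X w * Y w) = (fun w =>
    ((pos \o X) w * (pos \o Y) w - (pos \o X) w * (neg \o Y) w) -
    ((neg \o X) w * (pos \o Y) w - (neg \o X) w * (neg \o Y) w)).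
  by apply/funext => w /=; rewrite {1}[X w]posneg {1}[Y w]posneg; ring.
split; first by apply: L1B; exact: L1B.
rewrite meanB; [|exact: L1B|exact: L1B].
by rewrite !meanB// pp pn np nn [mean P X]mE// [mean P Y]mE//; ring.
Qed.


Lemma mean_cross0 X Y : L1 P X -> L1 P Y -> indep_rv X Y ->
  mean P (fun w => (X w - mean P X) * (Y w - mean P Y)) = 0.
Proof.
move=> X1 Y1 XY.
have sub_meas (c : R) : measurable_fun setT (fun x : R => x - c).
  exact: measurable_funB.
have [_] := mean_mul (L1B X1 (L1_cst P (mean P X))) (L1B Y1 (L1_cst P (mean P Y)))
  (indep_rv_comp (sub_meas _) (sub_meas _) XY).
by move=> ->; rewrite meanB//; [rewrite mean_cst subrr mul0r|exact: L1_cst].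
Qed.

(** Pairwise independence kills the cross terms; each remaining variance is at
    most the mean squared distance to any constant [c i]. *)
Lemma variance_sum_le (n : nat) (Y : 'I_n -> T -> R) (c : 'I_n -> R) :
  (forall i, measurable_fun setT (Y i)) ->
  (forall i, L1 P (fun w => Y i w ^+ 2)) ->
  (forall i j, i != j -> indep_rv (Y i) (Y j)) ->
  L1 P (fun w => (\sum_(i < n) Y i w - \sum_(i < n) mean P (Y i)) ^+ 2) /\
  mean P (fun w => (\sum_(i < n) Y i w - \sum_(i < n) mean P (Y i)) ^+ 2) <=
  \sum_(i < n) mean P (fun w => (Y i w - c i) ^+ 2).
Proof.
move=> mY Y2 indY; have Y1 i : L1 P (Y i) by exact: L1_of_sqr.
pose D i w := Y i w - mean P (Y i).
have mD i : measurable_fun setT (D i) by exact: measurable_funB.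
have sqrB1 i (b : R) : L1 P (fun w => (Y i w - b) ^+ 2).
  by apply: (L1_sqrD (g := fun=> - b)) => //; exact: L1_cst.
have DD i j : L1 P (fun w => D i w * D j w) by apply: L1_mul => //; exact: sqrB1.
have E : (fun w => (\sum_(i < n) Y i w - \sum_(i < n) mean P (Y i)) ^+ 2) =
    (fun w => \sum_(i < n) \sum_(j < n) D i w * D j w).
  apply/funext => w; rewrite -sumrB expr2 big_distrl /=.
  by apply: eq_bigr => i _; rewrite big_distrr.
rewrite E; split; first by apply: L1_sum => i; apply: L1_sum.
rewrite mean_sum; last by move=> i; exact: L1_sum.
apply: ler_sum => i _; rewrite mean_sum// (bigD1 i)//= big1 ?addr0; last first.
  by move=> j ji; apply: mean_cross0 => //; apply: indY; rewrite eq_sym.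
set m := mean P (Y i).
have -> : (fun w => (Y i w - c i) ^+ 2) =
    (fun w => D i w * D i w + (2 * (m - c i) * D i w + (m - c i) ^+ 2)).
  by apply/funext => w; rewrite /D -/m; ring.
have D1 : L1 P (D i) by exact: L1B (L1_cst _ _).
have D0 : mean P (D i) = 0 by rewrite meanB ?mean_cst ?subrr//; exact: L1_cst.
rewrite meanD//; last by apply: L1D; [exact: L1Z|exact: L1_cst].
rewrite meanD ?meanZ ?mean_cst//; do ?[exact: L1_cst|exact: L1Z].
by rewrite D0 mulr0 add0r lerDl sqr_ge0.
Qed.

Lemma mutually_independent_pair (J : finType) (X : J -> T -> R) i j :
  mutually_independent P X -> i != j -> indep_rv (X i) (X j).
Proof.
move=> indX ij A B mA mB.
pose C k := if k == i then A else if k == j then B else setT.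
have mC k : measurable (C k) by rewrite /C; case: eqP => // _; case: eqP.
have ji : (j == i) = false by rewrite eq_sym (negbTE ij).
transitivity (P (\bigcap_(k in setT) (X k @^-1` C k))).
  congr (P _); apply/seteqP; split=> [w [Aw Bw] k _|w h].
    by rewrite /C /=; case: eqP => [->//|_]; case: eqP => [->|].
  by have := h i I; have := h j I; rewrite /C /= !eqxx ji.
rewrite indX// (bigD1 i)//= (bigD1 j) ?ji//= /C !eqxx ji.
rewrite [X in (_ * (_ * X))%E]big1 ?mule1// => k /andP[/negbTE -> /negbTE ->].
by rewrite preimage_setT probability_setT.
Qed.

End Independence.

(** * The standard normal law *)

Lemma measurable_sqrt {R : realType} : measurable_fun [set: R] (@Num.sqrt R).
Proof. by apply: continuous_measurable_fun; exact: sqrt_continuous. Qed.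

Lemma measurable_invsqrt {R : realType} :
  measurable_fun [set: R] (fun x : R => (Num.sqrt x)^-1).
Proof.
rewrite (_ : (fun x => _) = (@powR R ^~ (-1)) \o Num.sqrt); last first.
  by apply/funext => x /=; rewrite powR_inv1.
by apply: measurableT_comp; [exact: measurable_powR|exact: measurable_sqrt].
Qed.

Section NormalLaw.
Context {R : realType}.
Notation N01 := (@normal_prob R 0 1).

Let m_pdf (s : R) : measurable_fun setT (fun x => (normal_pdf 0 s x)%:E).
Proof. by apply/measurable_EFinP; exact: measurable_normal_pdf. Qed.

Lemma normal_probN (A : set R) : measurable A -> N01 (-%R @^-1` A) = N01 A.
Proof.
move=> mA; rewrite /normal_prob.
have pdfN (x : R) : normal_pdf 0 1 (- x) = normal_pdf 0 1 x.
  by rewrite /normal_pdf oner_eq0 /normal_fun !subr0 sqrrN.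
pose f x : \bar R := (normal_pdf 0 1 x)%:E.
transitivity (\int[lebesgue_measure]_(x in
    (-%R : _ -> measurableTypeR R) @^-1` A) (f \o -%R) x)%E.
  by apply: eq_integral => x _; rewrite /f /= pdfN.
rewrite -ge0_integral_pushforward//=.
- by apply: eq_measure_integral => B mB _; exact: lebesgue_measureN.
- exact: measurable_funTS (m_pdf 1).
- by move=> x _; rewrite lee_fin normal_pdf_ge0.
Qed.

Lemma normal_prob_set1 (x : R) : N01 [set x] = 0%E.
Proof.
have /null_content_dominatesP h := normal_prob_dominates (R := R) 0 1.
by apply: h => //; exact: lebesgue_measure_set1.
Qed.

Import Radon_Nikodym_SigmaFinite.

(** The normal density is almost everywhere equal to the Radon-Nikodym
    derivative of the law, for which the change of variables is known. *)
Lemma integral_normal_prob (g : R -> \bar R) : measurable_fun setT g ->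
  (forall x, 0 <= g x)%E ->
  (\int[N01]_x g x = \int[lebesgue_measure]_x (g x * (normal_pdf 0 1 x)%:E))%E.
Proof.
move=> mg g0; have dom := normal_prob_dominates (R := R) 0 1.
rewrite -(change_of_variables dom)//.
have fi := f_integrable dom.
apply: ae_eq_integral => //.
- by apply: emeasurable_funM => //; exact: measurable_int fi.
- by apply: emeasurable_funM => //; exact: m_pdf.
apply: ae_eqe_mul2l; apply: integral_ae_eq => //.
- exact: m_pdf.
by move=> E _ mE; rewrite -(f_integral dom).
Qed.

(** Since [x ^+ 4 <= 32 * expR (x ^+ 2 / 4)], the integrand is at most a
    multiple of the normal density of variance [2]. *)
Lemma normal_moment4_lty : (\int[N01]_x (x ^+ 4)%:E < +oo)%E.
Proof.
have s2 : Num.sqrt 2 != 0 :> R by rewrite gt_eqF// sqrtr_gt0.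
pose c : R := 32 * (normal_peak 1 / normal_peak (Num.sqrt 2)).
have p2 := normal_peak_gt0 s2.
have p1 : 0 < normal_peak (1 : R) by exact: normal_peak_gt0 (oner_neq0 _).
rewrite integral_normal_prob//; last 2 first.
- by apply/measurable_EFinP; exact: measurable_funX.
- by move=> x; rewrite lee_fin exprn_even_ge0.
apply: (@le_lt_trans _ _
  (\int[lebesgue_measure]_x (c * normal_pdf 0 (Num.sqrt 2) x)%:E)%E); last first.
  under eq_integral do rewrite EFinM.
  rewrite integralZl//; last exact: integrable_normal_pdf.
  by rewrite integral_normal_pdf mule1 ltry.
apply: ge0_le_integral => //.
- by move=> x _; rewrite mule_ge0// lee_fin ?normal_pdf_ge0 ?exprn_even_ge0.
- apply: emeasurable_funM; last exact: m_pdf.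
  by apply/measurable_EFinP; exact: measurable_funX.
- apply/measurable_EFinP; apply: measurable_funM => //.
  exact: measurable_normal_pdf.
move=> x _; rewrite -EFinM lee_fin.
rewrite /normal_pdf oner_eq0 (negbTE s2) /normal_fun !subr0.
have cE : c * normal_peak (Num.sqrt 2) = 32 * normal_peak 1.
  by rewrite /c -mulrA divfK// gt_eqF.
rewrite [c * _]mulrA cE; set k := normal_peak 1 in p1 cE *.
rewrite sqr_sqrtr// expr1n.
have e4 : x ^+ 4 * expR (- x ^+ 2 / (2 *+ 2)) <= 32.
  have -> : - x ^+ 2 / (2 *+ 2) = - (x ^+ 2 / 4).
    by rewrite mulNr -mulrnA.
  rewrite expRN ler_pdivrMr ?expR_gt0//.
  have := expR_ge1Dxn 1 (divr_ge0 (sqr_ge0 x) (ler0n R 4)).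
  rewrite (_ : (1.+1)`! = 2)%N// expr_div_n -exprM mulnn; lra.
have -> : - x ^+ 2 / (1 *+ 2) = - x ^+ 2 / (2 *+ 2) + - x ^+ 2 / (2 *+ 2).
  by field.
rewrite expRD; set e := expR _ in e4 *.
have ke : 0 <= k * e by rewrite mulr_ge0 ?expR_ge0// ltW.
have -> : x ^+ 4 * (k * (e * e)) = x ^+ 4 * e * (k * e) by ring.
by rewrite -[32 * k * e]mulrA ler_wpM2r.
Qed.

End NormalLaw.

(** * Standard Gaussian vectors *)

Section GaussianVector.
Context {d : measure_display} {T : measurableType d} {R : realType}.
Variable P : probability T R.
Context {q : nat}.
Notation N01 := (@normal_prob R 0 1).
Implicit Types X Y : 'I_q -> T -> R.

(** Independence and the marginal laws in a single condition on boxes; in this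
    form the invariance under sign changes and permutations is immediate. *)
Definition gaussian_vec X : Prop :=
  (forall i, measurable_fun setT (X i)) /\
  forall A : 'I_q -> set R, (forall i, measurable (A i)) ->
    P (\bigcap_(i in setT) X i @^-1` A i) = (\prod_(i < q) N01 (A i))%E.

Definition sign_change (b : pred 'I_q) (v : 'I_q -> R) (j : 'I_q) : R :=
  if b j then - v j else v j.

Definition flip (i : 'I_q) : ('I_q -> R) -> 'I_q -> R := sign_change (pred1 i).

Lemma gaussian_vec_sign_change X b : gaussian_vec X ->
  gaussian_vec (fun j w => sign_change b (X ^~ w) j).
Proof.
move=> [mX pX]; split.
  by move=> j; rewrite /sign_change; case: (b j) => //; exact: measurable_funN.
move=> A mA; pose B j := if b j then -%R @^-1` A j else A j.
have mB j : measurable (B j).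
  rewrite /B; case: (b j) => //; rewrite -[X in measurable X]setTI.
  exact: (@oppr_measurable R setT).
transitivity (P (\bigcap_(j in setT) X j @^-1` B j)).
  congr (P _); apply: eq_bigcapr => j _; rewrite /B /sign_change.
  by apply/seteqP; split=> w /=; case: (b j).
rewrite pX//; apply: eq_bigr => j _; rewrite /B; case: (b j) => //.
exact: normal_probN.
Qed.

Lemma gaussian_vec_perm X (s : {perm 'I_q}) : gaussian_vec X ->
  gaussian_vec (fun j => X (s j)).
Proof.
move=> [mX pX]; split=> // A mA.
transitivity (P (\bigcap_(j in setT) X j @^-1` A ((s^-1)%g j))).
  congr (P _); apply/seteqP; split=> w /= h j _ /=.
    by have := h ((s^-1)%g j) I; rewrite /= permKV.
  by have := h (s j) I; rewrite /= permK.
rewrite pX// (reindex_inj (@perm_inj _ s)); apply: eq_bigr => j _.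
by rewrite permK.
Qed.

Definition vec X w : q.-tuple R := [tuple X i w | i < q].

Lemma measurable_vec X : (forall i, measurable_fun setT (X i)) ->
  measurable_fun setT (vec X).
Proof.
move=> mX; apply/measurable_fun_tnthP => i.
by rewrite (_ : _ \o _ = X i)//; apply/funext => w; rewrite /= tnth_mktuple.
Qed.

Definition boxes : set (set (q.-tuple R)) :=
  [set B | exists2 A : 'I_q -> set R, (forall i, measurable (A i)) &
    B = \bigcap_(i in setT) [set t | A i (tnth t i)]].

Lemma measurable_boxes : boxes `<=` measurable.
Proof.
move=> _ [A mA ->]; apply: fin_bigcap_measurable => // i _.
by rewrite -[X in measurable X]setTI; exact: measurable_tnth.
Qed.

Lemma boxesT : boxes setT.
Proof. by exists (fun=> setT) => //; apply/seteqP; split. Qed.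

Lemma boxesI : setI_closed boxes.
Proof.
move=> _ _ [A1 mA1 ->] [A2 mA2 ->].
exists (fun i => A1 i `&` A2 i); first by move=> i; exact: measurableI.
by rewrite bigcapI.
Qed.

Lemma sub_boxes : @measurable _ (q.-tuple R) `<=` <<s boxes >>.
Proof.
apply: smallest_sub; first exact: smallest_sigma_algebra.
rewrite -bigcup_seq => B [i _ [A mA <-]]; apply: sub_sigma_algebra.
exists (fun j => if j == i then A else setT) => [j|]; first by case: eqP.
apply/seteqP; split=> [t [_ At] j _ /=|t h]; first by case: eqP => [->|].
by split=> //; have := h i I; rewrite /= eqxx.
Qed.

(** Boxes form a pi-system that generates the sigma-algebra of tuples, so two
    Gaussian vectors have the same law. *)
Lemma gaussian_vec_law X Y (B : set (q.-tuple R)) : gaussian_vec X ->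
  gaussian_vec Y -> measurable B -> P (vec X @^-1` B) = P (vec Y @^-1` B).
Proof.
move=> [mX pX] [mY pY] mB.
pose VX : {mfun T >-> q.-tuple R} := mfun_Sub (mem_set (measurable_vec mX)).
pose VY : {mfun T >-> q.-tuple R} := mfun_Sub (mem_set (measurable_vec mY)).
have vecE Z (A : 'I_q -> set R) :
    vec Z @^-1` (\bigcap_(i in setT) [set t | A i (tnth t i)]) =
    \bigcap_(i in setT) Z i @^-1` A i.
  by apply/seteqP; split=> w h i _; have := h i I; rewrite /= tnth_mktuple.
change (distribution P VX B = distribution P VY B).
apply: (g_sigma_algebra_measure_unique boxes _ (fun=> setT)) => //.
- exact: measurable_boxes.
- by move=> _; exact: boxesT.
- by rewrite bigcup_const//; exists 0%N.
- exact: boxesI.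
- move=> _ [A mA ->]; change (P (vec X @^-1` (\bigcap_(i in setT)
    [set t | A i (tnth t i)])) = P (vec Y @^-1` (\bigcap_(i in setT)
    [set t | A i (tnth t i)]))).
  by rewrite !vecE pX// pY.
- by move=> _; rewrite ltey_eq fin_num_measure.
- exact: sub_boxes.
Qed.

Lemma gaussian_vec_mean X Y (f : ('I_q -> R) -> R) :
  gaussian_vec X -> gaussian_vec Y ->
  measurable_fun setT (fun t : q.-tuple R => f (tnth t)) ->
  L1 P (fun w => f (X ^~ w)) -> L1 P (fun w => f (Y ^~ w)) ->
  mean P (fun w => f (X ^~ w)) = mean P (fun w => f (Y ^~ w)).
Proof.
move=> gX gY mf X1 Y1.
pose VX : {mfun T >-> q.-tuple R} := mfun_Sub (mem_set (measurable_vec gX.1)).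
pose VY : {mfun T >-> q.-tuple R} := mfun_Sub (mem_set (measurable_vec gY.1)).
pose g (t : q.-tuple R) : \bar R := (f (tnth t))%:E.
have fE Z : (fun w => (f (Z ^~ w))%:E) = g \o vec Z.
  apply/funext => w; rewrite /g /=; congr (f _)%:E.
  by apply/funext => i; rewrite tnth_mktuple.
have mg : measurable_fun setT g by exact/measurable_EFinP.
have [gX1 gY1] : P.-integrable setT (g \o VX) /\ P.-integrable setT (g \o VY).
  by split; rewrite /= -fE.
rewrite /mean /Rintegral; congr fine.
transitivity (\int[distribution P VX]_t g t)%E.
  rewrite integral_distribution//; apply: eq_integral => w _.
  exact: (congr1 (@^~ w) (fE _)).
transitivity (\int[distribution P VY]_t g t)%E; last first.
  rewrite integral_distribution//; apply: eq_integral => w _.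
  exact: (esym (congr1 (@^~ w) (fE _))).
by apply: eq_measure_integral => B mB _; exact: gaussian_vec_law.
Qed.

End GaussianVector.

(** * Directions of vectors *)

Section FiniteSums.
Context {R : realDomainType}.

(** Jensen's inequality for the square: with [S] and [M] the sums of [p i] and
    [p i * x i], add up the nonnegative [p i * (S * x i - M) ^+ 2]. *)
Lemma sqr_sum_weighted (n : nat) (p x : 'I_n -> R) : (forall i, 0 <= p i) ->
  (\sum_(i < n) p i * x i) ^+ 2 <=
  (\sum_(i < n) p i) * \sum_(i < n) p i * x i ^+ 2.
Proof.
move=> p0; set S := \sum_i p i; set M := \sum_i p i * x i.
set Q := \sum_i p i * x i ^+ 2.
have S0 : 0 <= S by exact: sumr_ge0.
have [S0'|Sn0] := eqVneq S 0.
  have z i : p i = 0.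
    by apply: (psumr_eq0P _ S0').
  have -> : M = 0 by rewrite /M big1// => i _; rewrite z mul0r.
  by rewrite S0' mul0r expr0n.
have Sp : 0 < S by rewrite lt_neqAle eq_sym Sn0.
have : 0 <= \sum_i p i * (S * x i - M) ^+ 2.
  by apply: sumr_ge0 => i _; rewrite mulr_ge0 ?sqr_ge0.
have -> : \sum_i p i * (S * x i - M) ^+ 2 = S * (S * Q - M ^+ 2).
  transitivity (\sum_i (S ^+ 2 * (p i * x i ^+ 2) - 2 * S * M * (p i * x i) +
      M ^+ 2 * p i)).
    by apply: eq_bigr => i _; ring.
  rewrite big_split sumrB /= -!mulr_sumr -/S -/M -/Q; ring.
by rewrite pmulr_rge0// subr_ge0.
Qed.

End FiniteSums.

Section Direction.
Context {R : realType} {q : nat}.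
Implicit Types v s : 'I_q -> R.

Definition sqnorm v : R := \sum_(k < q) v k ^+ 2.

Definition dir v (i : 'I_q) : R := (Num.sqrt (sqnorm v))^-1 * v i.

Definition dot s v : R := \sum_(k < q) s k * v k.

Lemma sqnorm_ge0 v : 0 <= sqnorm v.
Proof. by apply: sumr_ge0 => i _; rewrite sqr_ge0. Qed.

Lemma sqnorm_sign_change b v : sqnorm (sign_change b v) = sqnorm v.
Proof.
by apply: eq_bigr => j _; rewrite /sign_change; case: (b j); rewrite ?sqrrN.
Qed.

Lemma sqnorm_perm (s : {perm 'I_q}) v : sqnorm (v \o s) = sqnorm v.
Proof. by rewrite /sqnorm [RHS](reindex_inj (@perm_inj _ s)). Qed.

Lemma dir_sign_change b v : dir (sign_change b v) = sign_change b (dir v).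
Proof.
apply/funext => j; rewrite /dir sqnorm_sign_change /sign_change.
by case: (b j); rewrite ?mulrN.
Qed.

Lemma dir_perm (s : {perm 'I_q}) v : dir (v \o s) = dir v \o s.
Proof. by apply/funext => j; rewrite /dir sqnorm_perm. Qed.

Lemma sqnorm_dir v : sqnorm (dir v) = (sqnorm v != 0)%:R.
Proof.
rewrite {1}/sqnorm; under eq_bigr do rewrite exprMn exprVn sqr_sqrtr ?sqnorm_ge0//.
by rewrite -mulr_sumr -/(sqnorm v); case: eqVneq => [->|v0]; rewrite ?mulr0 ?mulVf.
Qed.

Lemma sqnorm_dir_le1 v : sqnorm (dir v) <= 1.
Proof. by rewrite sqnorm_dir lern1 leq_b1. Qed.

Lemma dir_sqr_le1 v i : dir v i ^+ 2 <= 1.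
Proof.
apply: le_trans (sqnorm_dir_le1 v); rewrite /sqnorm (bigD1 i)//= lerDl.
by apply: sumr_ge0 => j _; rewrite sqr_ge0.
Qed.

Lemma norm_dir_le1 v i : `|dir v i| <= 1.
Proof.
rewrite -ler_sqr ?nnegrE// expr1n real_normK ?num_real//.
exact: dir_sqr_le1.
Qed.

Lemma norm_dot_dir s v : `|dot s (dir v)| <= \sum_(i < q) `|s i|.
Proof.
apply: le_trans (ler_norm_sum _ _ _) _; apply: ler_sum => i _.
by rewrite normrM ler_piMr// norm_dir_le1.
Qed.

(** Borel functions of [q] real variables, read on tuples because those carry
    the product sigma-algebra. *)
Definition vmeas (f : ('I_q -> R) -> R) : Prop :=
  measurable_fun setT (fun t : q.-tuple R => f (tnth t)).

Lemma vmeasB f g : vmeas f -> vmeas g -> vmeas (fun v => f v - g v).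
Proof. exact: measurable_funB. Qed.

Lemma vmeasM f g : vmeas f -> vmeas g -> vmeas (fun v => f v * g v).
Proof. exact: measurable_funM. Qed.

Lemma vmeasZ c f : vmeas f -> vmeas (fun v => c * f v).
Proof. by move=> mf; apply: measurable_funM. Qed.

Lemma vmeasX f n : vmeas f -> vmeas (fun v => f v ^+ n).
Proof. exact: measurable_funX. Qed.

Lemma vmeas_coord i : vmeas (fun v => v i).
Proof. exact: measurable_tnth. Qed.

Lemma vmeas_sqnorm : vmeas sqnorm.
Proof.
by apply: measurable_sum => i; apply: measurable_funX; exact: vmeas_coord.
Qed.

Lemma vmeas_dir i : vmeas (fun v => dir v i).
Proof.
apply: measurable_funM; last exact: vmeas_coord.
exact: (measurableT_comp measurable_invsqrt vmeas_sqnorm).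
Qed.

Lemma vmeas_dot s : vmeas (fun v => dot s (dir v)).
Proof.
by apply: measurable_sum => i; apply: measurable_funM => //; exact: vmeas_dir.
Qed.

End Direction.

(** * Symmetries of a uniform direction *)

(** Writing [L ^+ 4] as the sum of the [a i * L ^+ 3] and expanding each one
    around [L - a i] gives at most [3 * Q * L ^+ 2], where [Q] is the sum of the
    [a i ^+ 2], plus terms that are odd in a single [a i]. The inequality of
    arithmetic and geometric means then absorbs [L ^+ 2]. The odd terms vanish
    in mean as soon as the law of the [a i] is invariant under flipping the sign
    of one of them. *)
Lemma pow4_sum_le {R : realFieldType} (n : nat) (a : 'I_n -> R) :
  forall L, L = \sum_(i < n) a i ->
  L ^+ 4 <= 9 * (\sum_(i < n) a i ^+ 2) ^+ 2 +
    2 * \sum_(i < n) (a i * (L - a i) ^+ 3 - 3 * a i ^+ 3 * (L - a i)).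
Proof.
move=> L LE; set Q := \sum_i a i ^+ 2; set G := \sum_i (_ - _).
have : L ^+ 4 <= 3 * Q * L ^+ 2 + G.
  have -> : L ^+ 4 = \sum_i a i * L ^+ 3 by rewrite -mulr_suml -LE exprS.
  rewrite mulrAC !mulr_sumr -big_split /=; apply: ler_sum => i _.
  rewrite -subr_ge0.
  have -> : 3 * L ^+ 2 * a i ^+ 2 +
      (a i * (L - a i) ^+ 3 - 3 * a i ^+ 3 * (L - a i)) - a i * L ^+ 3 =
      2 * (a i ^+ 2) ^+ 2 by ring.
  by rewrite mulr_ge0 ?sqr_ge0.
have := sqr_ge0 (3 * Q - L ^+ 2).
have -> : (3 * Q - L ^+ 2) ^+ 2 = 9 * Q ^+ 2 - 2 * (3 * Q * L ^+ 2) + L ^+ 4.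
  by ring.
lra.
Qed.

Section Sphere.
Context {d : measure_display} {T : measurableType d} {R : realType}.
Variable P : probability T R.
Context {q : nat}.
Variable X : 'I_q -> T -> R.
Hypothesis gX : gaussian_vec P X.
Hypothesis q0 : (0 < q)%N.

Let V w : 'I_q -> R := X ^~ w.

Lemma vmeas_vec (f : ('I_q -> R) -> R) : vmeas f ->
  measurable_fun setT (fun w => f (V w)).
Proof.
move=> mf; rewrite (_ : (fun w => _) = (fun t => f (tnth t)) \o vec X).
  by apply: measurableT_comp mf _; exact: measurable_vec gX.1.
apply/funext => w /=; congr f; apply/funext => i; by rewrite tnth_mktuple.
Qed.

Lemma L1_vec (f : ('I_q -> R) -> R) (c : R) : vmeas f ->
  (forall v, `|f v| <= c) -> L1 P (fun w => f (V w)).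
Proof. by move=> mf fc; apply: (@L1_bounded _ _ _ P _ c) => //; exact: vmeas_vec. Qed.

Lemma mean_flip (f : ('I_q -> R) -> R) (c : R) i : vmeas f ->
  (forall v, `|f v| <= c) ->
  mean P (fun w => f (flip i (V w))) = mean P (fun w => f (V w)).
Proof.
move=> mf fc; have gY := gaussian_vec_sign_change (pred1 i) gX.
apply: (gaussian_vec_mean gY gX) => //.
  apply: (@L1_bounded _ _ _ P _ c) => //.
  rewrite (_ : (fun w => _) = (fun t => f (tnth t)) \o vec (fun j w => flip i (X^~ w) j)).
    by apply: measurableT_comp mf _; exact: measurable_vec gY.1.
  apply/funext => w /=; congr f; apply/funext => j; by rewrite tnth_mktuple.
exact: L1_vec mf fc.
Qed.

Lemma mean_perm (f : ('I_q -> R) -> R) (c : R) (s : {perm 'I_q}) : vmeas f ->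
  (forall v, `|f v| <= c) ->
  mean P (fun w => f (V w \o s)) = mean P (fun w => f (V w)).
Proof.
move=> mf fc; have gY := gaussian_vec_perm s gX.
apply: (gaussian_vec_mean gY gX) => //.
  apply: (@L1_bounded _ _ _ P _ c) => //.
  rewrite (_ : (fun w => _) = (fun t => f (tnth t)) \o vec (fun j => X (s j))).
    by apply: measurableT_comp mf _; exact: measurable_vec gY.1.
  apply/funext => w /=; congr f; apply/funext => j; by rewrite tnth_mktuple.
exact: L1_vec mf fc.
Qed.

Lemma mean_odd (f : ('I_q -> R) -> R) (c : R) i : vmeas f ->
  (forall v, `|f v| <= c) -> (forall v, f (flip i v) = - f v) ->
  mean P (fun w => f (V w)) = 0.
Proof.
move=> mf fc fN; have := mean_flip i mf fc.
under [fun w => f (flip _ _)]funext do rewrite fN -mulN1r.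
by rewrite meanZ; [lra|exact: L1_vec mf fc].
Qed.

(** Exchangeable coordinates have equal means, so each carries a fraction
    [1 / q] of the mean of their sum. *)
Lemma mean_coord_share (f : 'I_q -> ('I_q -> R) -> R) (c : R) :
  (forall i, vmeas (f i)) -> (forall i v, `|f i v| <= c) ->
  (forall i (s : {perm 'I_q}) v, f i (v \o s) = f (s i) v) ->
  forall i, q%:R * mean P (fun w => f i (V w)) =
    mean P (fun w => \sum_(j < q) f j (V w)).
Proof.
move=> mf fc fs i; rewrite mean_sum; last by move=> j; exact: L1_vec (fc j).
transitivity (\sum_(j < q) mean P (fun w => f i (V w))).
  by rewrite sumr_const card_ord mulr_natl.
apply: eq_bigr => j _; rewrite -(mean_perm (tperm i j) (mf i) (fc i)).
by under [fun w => _]funext do rewrite fs tpermL.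
Qed.

Let U w := dir (V w).

Lemma mean_dir_cross i j : i != j -> mean P (fun w => U w i * U w j) = 0.
Proof.
move=> ij; apply: (@mean_odd (fun v => dir v i * dir v j) 1 i).
- by apply: measurable_funM; exact: vmeas_dir.
- by move=> v; rewrite normrM mulr_ile1// norm_dir_le1.
- move=> v; rewrite /flip !dir_sign_change /sign_change /= eqxx eq_sym (negbTE ij).
  by rewrite mulNr.
Qed.

Lemma gaussian_vec_marginal i (A : set R) : measurable A ->
  P (X i @^-1` A) = normal_prob 0 1 A.
Proof.
move=> mA; pose B j := if j == i then A else setT.
have mB j : measurable (B j) by rewrite /B; case: eqP.
transitivity (P (\bigcap_(j in setT) X j @^-1` B j)).
  congr (P _); apply/seteqP; split=> [w Aw j _|w h]; rewrite /B /=.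
    by case: eqP => [->|].
  by have := h i I; rewrite /B /= eqxx.
rewrite gX.2// (bigD1 i)//= big1 ?mule1 /B ?eqxx// => j /negbTE ->.
exact: probability_setT.
Qed.

Lemma L1_sqnorm_dir : L1 P (fun w => sqnorm (U w)).
Proof.
apply: (@L1_vec (fun v => sqnorm (dir v)) 1); last first.
  by move=> v; rewrite ger0_norm ?sqnorm_ge0 ?sqnorm_dir_le1.
by apply: measurable_sum => i; apply: measurable_funX; exact: vmeas_dir.
Qed.

(** A direction has norm 1 unless the vector vanishes, and the vector vanishes
    only on a null event. *)
Lemma mean_sqnorm_dir : mean P (fun w => sqnorm (U w)) = 1.
Proof.
pose i0 := Ordinal q0; pose Z := X i0 @^-1` [set 0].
have mZ : measurable Z.
  by rewrite -[X in measurable X]setTI; apply: gX.1.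
have Z0 : mean P (\1_Z) = 0.
  by apply: EFin_inj; rewrite mean_indic// gaussian_vec_marginal// normal_prob_set1.
apply/eqP; rewrite eq_le; apply/andP; split.
  rewrite -[leRHS](mean_cst P 1); apply: mean_le => // [||w].
  - exact: L1_sqnorm_dir.
  - exact: L1_cst.
  - exact: sqnorm_dir_le1.
rewrite -subr_le0 -{1}(mean_cst P 1) -meanB; [|exact: L1_cst|exact: L1_sqnorm_dir].
rewrite -Z0; apply: mean_le => [||w].
- by apply: L1B; [exact: L1_cst|exact: L1_sqnorm_dir].
- exact: integrable_indic.
rewrite sqnorm_dir indicE; case: eqVneq => [S0|]; last by rewrite subrr.
suff -> : w \in Z by rewrite subr0.
rewrite inE /Z /=; apply/eqP; rewrite -sqrf_eq0; apply/eqP.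
exact: (psumr_eq0P (fun k _ => sqr_ge0 (V w k)) S0).
Qed.

Lemma mean_dir_sqr i : mean P (fun w => U w i ^+ 2) = q%:R^-1.
Proof.
have qn0 : q%:R != 0 :> R by rewrite pnatr_eq0 -lt0n.
apply: (mulfI qn0); rewrite divff//.
transitivity (mean P (fun w => sqnorm (U w))); last exact: mean_sqnorm_dir.
apply: (@mean_coord_share (fun i v => dir v i ^+ 2) 1).
- by move=> j; apply: measurable_funX; exact: vmeas_dir.
- by move=> j v; rewrite ger0_norm ?sqr_ge0// dir_sqr_le1.
- by move=> j s v; rewrite dir_perm.
Qed.

End Sphere.

(** * Fourth moments of a uniform direction *)

Section FourthMoment.
Context {R : realType}.

Let measurable_id_R : measurable_fun setT (fun x : measurableTypeR R => x : R).
Proof. by move=> _ A mA; rewrite setTI. Qed.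

(** The normal law transported along the identity, so that it lives on the
    measurable space in which random variables take their values. *)
Definition std_normal : probability R R :=
  distribution (@normal_prob R 0 1 : probability (measurableTypeR R) R)
    (mfun_Sub (mem_set measurable_id_R)).

Local Notation N01 := std_normal.

Definition normal_m2 : R := mean N01 (fun x => x ^+ 2).
Definition normal_m4 : R := mean N01 (fun x => x ^+ 4).

Lemma L1_normal4 : L1 N01 (fun x => x ^+ 4).
Proof.
apply: L1_of_ge0; [exact: measurable_funX|by move=> x; exact: exprn_even_ge0|].
rewrite ge0_integral_distribution; first exact: normal_moment4_lty.
  by apply/measurable_EFinP; exact: measurable_funX.
by move=> x; rewrite lee_fin exprn_even_ge0.
Qed.

Lemma L1_normal2 : L1 N01 (fun x => x ^+ 2).
Proof.
apply: L1_of_sqr; first exact: measurable_funX.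
by under [fun w => _]funext do rewrite -exprM; exact: L1_normal4.
Qed.

Lemma normal_m4_ge0 : 0 <= normal_m4.
Proof. by apply: mean_ge0 => x; exact: exprn_even_ge0. Qed.

Lemma normal_m2_gt0 : 0 < normal_m2.
Proof.
have m0 : 0 <= normal_m2 by apply: mean_ge0 => x; exact: sqr_ge0.
rewrite lt_neqAle m0 andbT eq_sym; apply/eqP => m20.
pose h (x : R) : \bar R := (x ^+ 2)%:E.
have mh : measurable_fun setT h.
  by apply/measurable_EFinP; exact: measurable_funX.
have /(ae_eq_integral_abs N01 measurableT mh) : (\int[N01]_x `|h x| = 0)%E.
  transitivity (\int[N01]_x h x)%E.
    by apply: eq_integral => x _; rewrite /h /= ger0_norm ?sqr_ge0.
  by rewrite (mean_EFin L1_normal2) -/normal_m2 m20.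
case=> A [mA A0 sA].
have : (N01 setT <= N01 A + N01 [set 0%R])%E.
  apply: (le_trans _ (measureU2 _ _ _)) => //.
  apply: le_measure; rewrite ?inE//; first exact: measurableU.
  move=> x _; have [->|x0] := eqVneq x 0; first by right.
  left; apply: sA => /(_ I) [] /eqP; rewrite sqrf_eq0.
  exact/negP.
have -> : N01 [set 0%R] = 0%E by exact: normal_prob_set1.
have -> : N01 setT = 1%E by exact: probability_setT.
have -> : N01 A = 0%E by exact: A0.
by rewrite adde0 lee_fin ler10.
Qed.

Context {d : measure_display} {T : measurableType d}.
Variable P : probability T R.
Context {q : nat}.
Variable X : 'I_q -> T -> R.
Hypothesis gX : gaussian_vec P X.
Hypothesis q0 : (0 < q)%N.

Let V w : 'I_q -> R := X ^~ w.
Let U w := dir (V w).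

Lemma gaussian_vec_mean1 (g : R -> R) i : L1 N01 g ->
  L1 P (g \o X i) /\ mean P (g \o X i) = mean N01 g.
Proof.
move=> g1; have mg := L1_measurable g1.
pose Xi : {mfun T >-> R} := mfun_Sub (mem_set (gX.1 i)).
have law A : measurable A -> distribution P Xi A = N01 A.
  by move=> mA; exact: (gaussian_vec_marginal gX i mA).
have mgE : measurable_fun setT (EFin \o g).
  by apply/measurable_EFinP; exact: mg.
have L : L1 P (g \o X i).
  apply/integrableP; split.
    by apply/measurable_EFinP; apply: measurableT_comp => //; exact: gX.1.
  have /integrableP[_ h] := g1.
  change (\int[P]_w ((fun x => `|(g x)%:E|) \o Xi) w < +oo)%E.
  rewrite -ge0_integral_distribution//; last exact: measurableT_comp.
  apply: le_lt_trans h; rewrite le_eqVlt; apply/orP; left; apply/eqP.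
  by apply: eq_measure_integral => A mA _; exact: law.
split=> //; rewrite /mean /Rintegral; congr fine.
transitivity (\int[distribution P Xi]_x (EFin \o g) x)%E.
  by rewrite integral_distribution.
by apply: eq_measure_integral => A mA _; exact: law.
Qed.

Lemma gaussian_vec_indep : mutually_independent P X.
Proof.
move=> A mA; rewrite gX.2//; apply: eq_bigr => i _.
by rewrite (gaussian_vec_marginal gX).
Qed.

Let small (v : 'I_q -> R) : R := (sqnorm v < q%:R * normal_m2 / 2)%R%:R.

Let vmeas_small : vmeas small.
Proof.
rewrite /vmeas (_ : (fun t => _) = \1_[set t : q.-tuple R |
    sqnorm (tnth t) < q%:R * normal_m2 / 2]).
  apply: measurable_indic; rewrite -[X in measurable X]setTI.
  by apply: measurable_fun_ltr => //; exact: vmeas_sqnorm.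
apply/funext => t; rewrite indicE; congr (nat_of_bool _)%:R.
by apply/idP/idP; rewrite inE.
Qed.

Let q1 : 0 < q%:R :> R. Proof. by rewrite ltr0n. Qed.

(** Chebyshev's inequality: the squared norm has mean [q * normal_m2] and a
    variance of order [q]. *)
Lemma mean_small_le :
  mean P (fun w => small (V w)) <= 4 * normal_m4 / (q%:R * normal_m2 ^+ 2).
Proof.
have m20 := normal_m2_gt0.
pose Y i w := X i w ^+ 2.
have mY i : measurable_fun setT (Y i) by apply: measurable_funX; exact: gX.1.
have Y2E i : (fun w => Y i w ^+ 2) = (fun x => x ^+ 4) \o X i.
  by apply/funext => w; rewrite /Y -exprM.
have [Y2 mY2] : (forall i, L1 P (fun w => Y i w ^+ 2)) /\
    (forall i, mean P (fun w => Y i w ^+ 2) = normal_m4).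
  by split=> i; rewrite Y2E; have [] := gaussian_vec_mean1 i L1_normal4.
have meanY i : mean P (Y i) = normal_m2.
  by have [] := gaussian_vec_mean1 i L1_normal2.
have sqr_meas : measurable_fun setT (fun x : R => x ^+ 2) by exact: measurable_funX.
have [DL Dle] := variance_sum_le (fun=> 0) mY Y2 (fun i j ij =>
  indep_rv_comp sqr_meas sqr_meas (mutually_independent_pair gaussian_vec_indep ij)).
rewrite (eq_bigr (fun=> normal_m2)) in Dle DL; last by [].
rewrite sumr_const card_ord -[_ *+ q]mulr_natl in Dle DL.
apply: (@le_trans _ _ (4 / (q%:R * normal_m2) ^+ 2 * (q%:R * normal_m4))); last first.
  by rewrite le_eqVlt; apply/orP; left; apply/eqP; field; rewrite !gt_eqF.
have c0 : 0 <= 4 / (q%:R * normal_m2) ^+ 2 by rewrite divr_ge0// sqr_ge0.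
apply: (@le_trans _ _ (4 / (q%:R * normal_m2) ^+ 2 * mean P (fun w =>
    (\sum_(i < q) Y i w - q%:R * normal_m2) ^+ 2))).
  rewrite -meanZ//; apply: mean_le => [||w].
  - apply: (L1_vec gX (c := 1)) => // v.
    by rewrite /small; case: ltP; rewrite ?normr1 ?normr0.
  - exact: L1Z.
  rewrite /small -/(sqnorm (V w)); case: ltP => [lt|_]; last first.
    by rewrite mulr_ge0 ?sqr_ge0.
  rewrite mulrAC ler_pdivlMr ?exprn_gt0 ?mulr_gt0// mul1r.
  have := mulr_gt0 q1 m20; nra.
rewrite ler_wpM2l//; apply: le_trans Dle _.
rewrite (eq_bigr (fun=> normal_m4)); last first.
  by move=> i _; under [fun w => _]funext do rewrite subr0.
by rewrite sumr_const card_ord mulr_natl.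
Qed.

Definition sphere_c4 : R := 8 * normal_m4 / normal_m2 ^+ 2.

(** Where the squared norm is at least half its mean, the fourth power of a
    coordinate is at most [4 / (q * normal_m2) ^+ 2] times that of the Gaussian.
    On the remaining event it is at most the square of the coordinate, which by
    exchangeability contributes [1 / q] of the probability of the event, itself
    of order [1 / q]. *)
Lemma mean_dir_pow4 i : mean P (fun w => U w i ^+ 4) <= sphere_c4 / q%:R ^+ 2.
Proof.
have m20 := normal_m2_gt0.
pose f i v := dir v i ^+ 2 * small v.
have mf j : vmeas (f j).
  by apply: measurable_funM => //; apply: measurable_funX; exact: vmeas_dir.
have small01 v : 0 <= small v <= 1 by rewrite /small; case: ltP; rewrite lexx ler01.
have fb j v : `|f j v| <= 1.
  have /andP[s0 s1] := small01 v.
  have u0 := sqr_ge0 (dir v j); have u1 := dir_sqr_le1 v j.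
  by rewrite /f ger0_norm; [exact: mulr_ile1|exact: mulr_ge0].
have fperm j (s : {perm 'I_q}) v : f j (v \o s) = f (s j) v.
  by rewrite /f dir_perm /small sqnorm_perm.
have fle : q%:R * mean P (fun w => f i (V w)) <=
    4 * normal_m4 / (q%:R * normal_m2 ^+ 2).
  rewrite (mean_coord_share gX mf fb fperm); apply: le_trans mean_small_le.
  apply: mean_le => [||w].
  - by apply: L1_sum => j; exact: (L1_vec gX (mf j) (fb j)).
  - apply: (L1_vec gX (c := 1)) => // v.
    by have /andP[s0 s1] := small01 v; rewrite ger0_norm.
  - rewrite -mulr_suml; have /andP[s0 s1] := small01 (V w).
    by rewrite ler_piMl//; exact: sqnorm_dir_le1.
have [X4 X4m] := gaussian_vec_mean1 i L1_normal4.
have -> : sphere_c4 / q%:R ^+ 2 =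
    4 / (q%:R * normal_m2) ^+ 2 * normal_m4 +
    q%:R^-1 * (4 * normal_m4 / (q%:R * normal_m2 ^+ 2)).
  by rewrite /sphere_c4; field; rewrite !gt_eqF.
apply: (@le_trans _ _ (4 / (q%:R * normal_m2) ^+ 2 * mean P ((fun x => x ^+ 4) \o X i) +
    mean P (fun w => f i (V w)))); last first.
  by rewrite X4m lerD// ler_pdivlMl.
rewrite -meanZ// -meanD; [|exact: L1Z|exact: L1_vec (mf i) (fb i)].
have mU4 : @vmeas R q (fun v => dir v i ^+ 4) by exact: vmeasX (vmeas_dir i).
have U4 (v : 'I_q -> R) : dir v i ^+ 4 <= dir v i ^+ 2.
  by rewrite (_ : 4 = 2 * 2)%N// exprM expr2 ler_piMl ?sqr_ge0// dir_sqr_le1.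
apply: mean_le => [||w].
- apply: (L1_vec gX mU4 (c := 1)) => v.
  by rewrite ger0_norm ?exprn_even_ge0// (le_trans (U4 v))// dir_sqr_le1.
- by apply: L1D; [exact: L1Z|exact: (L1_vec gX (mf i) (fb i))].
rewrite /= /f /small; case: ltP => [_|ge].
  by rewrite mulr1 (le_trans (U4 _))// lerDr mulr_ge0 ?divr_ge0 ?sqr_ge0 ?exprn_even_ge0.
rewrite mulr0 addr0 /U /dir exprMn ler_wpM2r ?exprn_even_ge0//.
have S0 : 0 < q%:R * normal_m2 / 2 by rewrite divr_gt0 ?mulr_gt0.
have S1 := lt_le_trans S0 ge.
have -> : (Num.sqrt (sqnorm (V w)))^-1 ^+ 4 = (sqnorm (V w) ^+ 2)^-1.
  by rewrite exprVn (_ : 4 = 2 * 2)%N// exprM sqr_sqrtr// ltW.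
have -> : 4 / (q%:R * normal_m2) ^+ 2 = ((q%:R * normal_m2 / 2) ^+ 2)^-1.
  by field; rewrite !gt_eqF.
by rewrite lef_pV2 ?posrE ?exprn_gt0//; apply: lerXn2r; rewrite ?nnegrE// ltW.
Qed.

(** [pow4_sum_le] for the terms [s i * u i], whose odd part has mean zero by
    sign flips; Jensen's inequality with weights [s i ^+ 2] then reduces to
    single coordinates. *)
Lemma mean_dot_pow4 (s : 'I_q -> R) :
  mean P (fun w => dot s (U w) ^+ 4) <=
  9 * sphere_c4 * (sqnorm s / q%:R) ^+ 2.
Proof.
pose a v i := s i * dir v i.
pose g i v := a v i * (dot s (dir v) - a v i) ^+ 3 -
  3 * a v i ^+ 3 * (dot s (dir v) - a v i).
have ma i : vmeas (fun v => a v i) by apply: vmeasZ; exact: vmeas_dir.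
have mL := @vmeas_dot R q s.
have mLa i : vmeas (fun v => dot s (dir v) - a v i) by exact: vmeasB.
have mg i : vmeas (g i).
  apply: vmeasB; first by apply: vmeasM => //; exact: vmeasX.
  by apply: vmeasM => //; apply: vmeasZ; exact: vmeasX.
pose B := \sum_(i < q) `|s i|.
have B0 : 0 <= B by exact: sumr_ge0.
have LB v : `|dot s (dir v)| <= B := norm_dot_dir s v.
have aB v i : `|a v i| <= B.
  rewrite normrM; apply: (@le_trans _ _ `|s i|).
    by rewrite ler_piMr// norm_dir_le1.
  by rewrite /B (bigD1 i)//= lerDl sumr_ge0.
have LaB v i : `|dot s (dir v) - a v i| <= B + B.
  by apply: le_trans (ler_normB _ _) _; exact: lerD.
have gc i v : `|g i v| <= B * (B + B) ^+ 3 + 3 * B ^+ 3 * (B + B).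
  apply: le_trans (ler_normB _ _) _; 
  rewrite (normrM (a v i)) (normrM (3 * _)) (normrM 3) !normrX normr_nat.
  have h n x y : 0 <= x -> x <= y -> x ^+ n <= y ^+ n :> R.
    by move=> x0 xy; apply: lerXn2r => //; rewrite nnegrE// (le_trans x0).
  apply: lerD; first by apply: ler_pM => //; exact: h.
  apply: ler_pM => //.
  by rewrite ler_wpM2l//; exact: h.
have g0 i : mean P (fun w => g i (V w)) = 0.
  apply: (mean_odd gX (mg i) (gc i) (i := i)) => v.
  have aN : a (flip i v) i = - a v i.
    by rewrite /a /flip dir_sign_change /sign_change /= eqxx mulrN.
  have LN : dot s (dir (flip i v)) - a (flip i v) i = dot s (dir v) - a v i.
    rewrite /dot (bigD1 i)//= [in RHS](bigD1 i)//= [_ + _ - _]addrAC subrr add0r.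
    rewrite [RHS]addrAC subrr add0r.
    by apply: eq_bigr => j /negbTE ji; rewrite /flip dir_sign_change /sign_change /= ji.
  by rewrite /g LN aN; ring.
pose Q w := \sum_(i < q) s i ^+ 2 * U w i ^+ 4.
have U4L i : L1 P (fun w => U w i ^+ 4).
  apply: (L1_vec gX (f := fun v => dir v i ^+ 4) (c := 1)) => [|v].
    by apply: vmeasX; exact: vmeas_dir.
  by rewrite normrX exprn_ile1// norm_dir_le1.
have QL : L1 P Q by apply: L1_sum => i; exact: L1Z.
have L4 : L1 P (fun w => dot s (U w) ^+ 4).
  apply: (L1_vec gX (f := fun v => dot s (dir v) ^+ 4) (c := B ^+ 4)) => [|v].
    exact: vmeasX.
  by rewrite normrX; apply: lerXn2r.
have gL i : L1 P (fun w => g i (V w)) by exact: (L1_vec gX (mg i) (gc i)).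
apply: (@le_trans _ _ (mean P (fun w => 9 * sqnorm s * Q w + 2 * \sum_(i < q) g i (V w)))).
  apply: mean_le => [||w] //.
    by apply: L1D; apply: L1Z => //; exact: L1_sum.
  apply: le_trans (pow4_sum_le (L := dot s (U w)) (a := a (V w)) _) _ => //.
  rewrite lerD2r -mulrA ler_wpM2l//.
  under eq_bigr do rewrite /a exprMn.
  apply: le_trans (sqr_sum_weighted _ _) _ => [i|]; first exact: sqr_ge0.
  rewrite le_eqVlt; apply/orP; left; apply/eqP; congr (_ * _).
  by apply: eq_bigr => i _; rewrite -exprM.
have G1 : L1 P (fun w => \sum_(i < q) g i (V w)) by exact: L1_sum.
have G0 : mean P (fun w => \sum_(i < q) g i (V w)) = 0.
  by rewrite mean_sum// big1.
rewrite (meanD (L1Z _ QL) (L1Z _ G1)) (meanZ _ QL) (meanZ _ G1) G0 mulr0 addr0.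
have -> : 9 * sphere_c4 * (sqnorm s / q%:R) ^+ 2 =
    9 * sqnorm s * (sqnorm s * (sphere_c4 / q%:R ^+ 2)).
  by field; rewrite gt_eqF.
rewrite ler_wpM2l ?mulr_ge0 ?sqnorm_ge0// mean_sum; last by move=> i; exact: L1Z.
rewrite {1}/sqnorm mulr_suml; apply: ler_sum => i _.
by rewrite meanZ// ler_wpM2l ?sqr_ge0// mean_dir_pow4.
Qed.

End FourthMoment.

(** * Independence across the sample *)

Section SampleIndependence.
Context {d : measure_display} {T : measurableType d} {R : realType}.
Variable P : probability T R.
Context {n q : nat}.
Variable z : 'I_n -> 'I_q -> {RV P >-> R}.
Hypothesis hz : iid_standard_gaussian_vectors z.

Let Z t i : T -> R := z t i.

Let mZ t i : measurable_fun setT (Z t i).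
Proof. exact: measurable_funPT. Qed.

Lemma iid_gaussian_boxes (C : 'I_n -> 'I_q -> set R) :
  (forall t i, measurable (C t i)) ->
  P (\bigcap_(t in setT) \bigcap_(i in setT) Z t i @^-1` C t i) =
  (\prod_(t < n) \prod_(i < q) normal_prob 0 1 (C t i))%E.
Proof.
move=> mC; have [hi hn] := hz.
rewrite pair_bigA /=.
transitivity (P (\bigcap_(ti in setT) Z ti.1 ti.2 @^-1` C ti.1 ti.2)).
  congr (P _); apply/seteqP; split=> w h.
    by move=> [t i] _; exact: h.
  by move=> t _ i _; exact: (h (t, i) I).
rewrite (hi (fun ti => C ti.1 ti.2))//; apply: eq_bigr => -[t i] _ /=.
exact: (hn t i _ (mC t i)).
Qed.

Lemma iid_gaussian_vec t : gaussian_vec P (Z t).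
Proof.
split=> // A mA.
have := @iid_gaussian_boxes (fun s i => if s == t then A i else setT).
rewrite (bigD1 t)//= [X in (_ * X)%E]big1 ?mule1; last first.
  by move=> s /negbTE ->; rewrite big1// => i _; exact: probability_setT.
rewrite eqxx => <-.
  congr (P _); apply/seteqP; split=> w h.
    by move=> s _ i _ /=; case: eqP => // ->; exact: h.
  by move=> i _; have := h t I i I; rewrite /= eqxx.
by move=> s i; case: eqP.
Qed.

Lemma iid_gaussian_indep s t : s != t -> indep_rv P (vec (Z s)) (vec (Z t)).
Proof.
move=> st.
apply: (indep_rv_pi _ _ sub_boxes measurable_boxes boxesT boxesI
  sub_boxes measurable_boxes boxesT boxesI).
- exact: measurable_vec.
- exact: measurable_vec.
move=> _ _ [A mA ->] [B mB ->].
have vecE t' (C : 'I_q -> set R) :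
    vec (Z t') @^-1` (\bigcap_(i in setT) [set x | C i (tnth x i)]) =
    \bigcap_(i in setT) Z t' i @^-1` C i.
  by apply/seteqP; split=> w h i _; have := h i I; rewrite /= tnth_mktuple.
rewrite !vecE (iid_gaussian_vec s).2// (iid_gaussian_vec t).2//.
pose C r i := if r == s then A i else if r == t then B i else setT.
have ts : (t == s) = false by rewrite eq_sym (negbTE st).
have := @iid_gaussian_boxes C.
rewrite (bigD1 s)//= (bigD1 t) ?ts//= [X in (_ * (_ * X))%E]big1 ?mule1; last first.
  move=> r /andP[/negbTE rs /negbTE rt]; rewrite big1// => i _.
  by rewrite /C rs rt; exact: probability_setT.
rewrite /C eqxx ts eqxx => <-.
  congr (P _); apply/seteqP; split=> [w [hA hB] r _ i _|w h].
    by case: eqP => [->|_]; [exact: hA|case: eqP => [->|//]; exact: hB].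
  by split=> i _; [have := h s I i I|have := h t I i I]; rewrite ?eqxx ?ts.
by move=> r i; case: eqP => // _; case: eqP.
Qed.

(** The direction as a Borel map on tuples, so that independence passes from
    the Gaussian vectors to their directions. *)
Definition dir_tuple (x : q.-tuple R) : q.-tuple R := [tuple dir (tnth x) i | i < q].

Lemma measurable_dir_tuple : measurable_fun setT dir_tuple.
Proof.
apply/measurable_fun_tnthP => i.
rewrite (_ : _ \o _ = (fun x : q.-tuple R => dir (tnth x) i)).
  exact: vmeas_dir.
by apply/funext => x; rewrite /= tnth_mktuple.
Qed.

Lemma directionE t w i : direction (z t) w i ord0 = dir (fun j => Z t j w) i.
Proof.
rewrite /direction /dir /norm2 !mxE; congr (_^-1 * _); congr Num.sqrt.
by apply: eq_bigr => j _; rewrite mxE.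
Qed.

Let D t w : q.-tuple R := dir_tuple (vec (Z t) w).

Lemma tnth_dir_vec t w i : tnth (D t w) i = direction (z t) w i ord0.
Proof.
rewrite tnth_mktuple directionE; congr (dir _ _).
by apply/funext => j; rewrite tnth_mktuple.
Qed.

Let mD t : measurable_fun setT (D t).
Proof.
by apply: measurableT_comp; [exact: measurable_dir_tuple|exact: measurable_vec].
Qed.

Variable xi : 'I_n -> {RV P >-> R}.
Hypothesis ixi : mutually_independent P (fun t => xi t : T -> R).
Hypothesis ixiu : independent_families P (fun t => xi t : T -> R)
  (fun (ti : 'I_n * 'I_q) w => direction (z ti.1) w ti.2 ord0).

Lemma sigma_of_preimage (I : finType) (X : I -> T -> R) i (A : set R) :
  measurable A -> sigma_of X (X i @^-1` A).
Proof.
move=> mA; apply: sub_sigma_algebra; exists i => //; exists A => //.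
by rewrite setTI.
Qed.

Lemma sigma_of_setI (I : finType) (X : I -> T -> R) A B :
  sigma_of X A -> sigma_of X B -> sigma_of X (A `&` B).
Proof.
rewrite /sigma_of; set G := \bigcup_(i in _) _ => sA sB.
exact: (@measurableI _ (g_sigma_algebraType G) A B).
Qed.

Let sigma_D t (B : set (q.-tuple R)) : measurable B ->
  sigma_of (fun (ti : 'I_n * 'I_q) w => direction (z ti.1) w ti.2 ord0)
    (D t @^-1` B).
Proof.
set u := fun ti w => _; move=> mB.
pose G := \bigcup_(i in setT) preimage_set_system setT (u i) measurable.
have mDG : measurable_fun [set: g_sigma_algebraType G] (D t).
  apply/measurable_fun_tnthP => i _ A mA; rewrite setTI.
  rewrite (_ : _ @^-1` A = u (t, i) @^-1` A); first exact: sigma_of_preimage.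
  by apply/seteqP; split=> w; rewrite /preimage /= tnth_dir_vec.
by have := mDG measurableT B mB; rewrite setTI.
Qed.

Lemma scale_direction_indep t : indep_rv P (xi t) (D t).
Proof.
move=> A B mA mB; apply: ixiu; last exact: sigma_D.
exact: (sigma_of_preimage (X := fun t => xi t)).
Qed.

(** The scales are independent of the directions, and each of the two families
    is independent across the sample; together this factors the probability of
    any event on two scales and two directions. *)
Lemma sample_indep s t : s != t ->
  indep_rv P (fun w => (xi s w, D s w)) (fun w => (xi t w, D t w)).
Proof.
move=> st; apply: indep_rv_pairs => //.
- exact: (mutually_independent_pair ixi).
- exact: (indep_rv_comp measurable_dir_tuple measurable_dir_tuple
    (iid_gaussian_indep st)).
move=> A1 A2 B1 B2 mA1 mA2 mB1 mB2; apply: ixiu.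
  by apply: sigma_of_setI; exact: (sigma_of_preimage (X := fun t => xi t)).
by apply: sigma_of_setI; exact: sigma_D.
Qed.

End SampleIndependence.

(** * Moments of projections and quadratic forms *)

Section ProjectionMoments.
Context {d : measure_display} {T : measurableType d} {R : realType}.
Variable P : probability T R.
Context {q : nat}.
Variable X : 'I_q -> T -> R.
Hypothesis gX : gaussian_vec P X.

Let V w : 'I_q -> R := X ^~ w.
Let U w := dir (V w).

Lemma dot_dir_opp s (v : 'I_q -> R) :
  dot s (dir (sign_change predT v)) = - dot s (dir v).
Proof.
rewrite dir_sign_change /dot -sumrN; apply: eq_bigr => i _.
by rewrite /sign_change /= mulrN.
Qed.

(** Given the scale [Y], the projection is symmetric because the direction is,
    so the odd function [g] has conditional mean zero. Adding [c] makes the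
    integrand nonnegative, as Tonelli's theorem requires. *)
Lemma mean_odd_scaled_dot (g : R -> R) (c : R) (Y : T -> R) (s : 'I_q -> R) :
  measurable_fun setT g -> (forall x, `|g x| <= c) ->
  (forall x, g (- x) = - g x) -> measurable_fun setT Y ->
  indep_rv P Y (fun w => dot s (U w)) ->
  mean P (fun w => g (Y w * dot s (U w))) = 0.
Proof.
move=> mg gc gN mY YD.
have mD : measurable_fun setT (fun w => dot s (U w)).
  exact: (vmeas_vec gX (vmeas_dot s)).
have inner0 (y : R) : mean P (fun w => g (y * dot s (U w))) = 0.
  pose f v := g (y * dot s (dir v)).
  have mf : vmeas f by apply: measurableT_comp => //; exact: vmeasZ (vmeas_dot s).
  have fL Y' : gaussian_vec P Y' -> L1 P (fun w => f (Y' ^~ w)).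
    by move=> gY; apply: (L1_vec gY mf) => v; exact: gc.
  have gY := gaussian_vec_sign_change predT gX.
  have := gaussian_vec_mean gY gX mf (fL _ gY) (fL _ gX).
  rewrite (_ : (fun w => f _) = (fun w => -1 * f (V w))); last first.
    by apply/funext => w; rewrite /f dot_dir_opp mulrN gN mulN1r.
  rewrite meanZ; last exact: fL.
  by rewrite -/V => e; have : mean P (fun w => f (V w)) = 0 by lra.
have c0 y : 0 <= c + g y.
  by have := gc y; rewrite ler_norml => /andP[+ _]; lra.
have mcg : measurable_fun setT (fun p : R * R => c + g (p.1 * p.2)).
  apply: measurable_funD => //; apply: measurableT_comp => //.
  exact: measurable_funM.
have := integral_pair_ge0 mY mD YD mcg (fun p => c0 _).
have gL (y : T -> R) : measurable_fun setT y ->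
    L1 P (fun w => g (y w * dot s (U w))).
  move=> my; apply: (@L1_bounded _ _ _ P _ c) => // .
  by apply: measurableT_comp => //; exact: measurable_funM.
rewrite (mean_EFin (L1D (L1_cst P c) (gL Y mY))) (eq_integral (fun=> c%:E)).
  rewrite meanD ?mean_cst; [|exact: L1_cst|exact: gL].
  by rewrite integral_cst// [X in (_ * X)%E]probability_setT mule1 => -[]; lra.
move=> v _; rewrite (mean_EFin (L1D (L1_cst P c) (gL (fun=> Y v) _)))//.
rewrite meanD ?mean_cst; [|exact: L1_cst|exact: (gL (fun=> Y v))].
by rewrite (inner0 (Y v)) addr0.
Qed.

Hypothesis q0 : (0 < q)%N.

Lemma L1_dot_pow s k : L1 P (fun w => dot s (U w) ^+ k).
Proof.
apply: (L1_vec gX (f := fun v => dot s (dir v) ^+ k)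
  (c := (\sum_(i < q) `|s i|) ^+ k)) => [|v].
  exact: vmeasX (vmeas_dot s).
rewrite normrX; apply: lerXn2r; rewrite ?nnegrE ?sumr_ge0//.
exact: norm_dot_dir.
Qed.

Lemma mean_dot_sqr s : mean P (fun w => dot s (U w) ^+ 2) = sqnorm s / q%:R.
Proof.
have UL i j : L1 P (fun w => U w i * U w j).
  apply: (L1_vec gX (f := fun v => dir v i * dir v j) (c := 1)) => [|v].
    by apply: vmeasM; exact: vmeas_dir.
  by rewrite normrM mulr_ile1// norm_dir_le1.
have -> : (fun w => dot s (U w) ^+ 2) =
    (fun w => \sum_(i < q) \sum_(j < q) (s i * s j) * (U w i * U w j)).
  apply/funext => w; rewrite expr2 /dot big_distrl /=; apply: eq_bigr => i _.
  by rewrite big_distrr /=; apply: eq_bigr => j _; ring.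
have sUL i j : L1 P (fun w => (s i * s j) * (U w i * U w j)) by exact: L1Z.
rewrite mean_sum; last by move=> i; exact: L1_sum.
rewrite /sqnorm mulr_suml; apply: eq_bigr => i _.
rewrite mean_sum// (bigD1 i)//= big1 ?addr0; last first.
  by move=> j ji; rewrite meanZ// mean_dir_cross 1?eq_sym// mulr0.
by rewrite meanZ// -(mean_dir_sqr gX q0 i).
Qed.

Variables (m : nat) (S : 'I_m -> 'I_q -> R).

Definition quad (v : 'I_q -> R) : R := \sum_(i < m) dot (S i) (dir v) ^+ 2.

Let A : R := \sum_(i < m) sqnorm (S i).

Lemma vmeas_quad : vmeas quad.
Proof.
by apply: measurable_sum => i; apply: measurable_funX; exact: vmeas_dot.
Qed.

Lemma quad_ge0 v : 0 <= quad v.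
Proof. by apply: sumr_ge0 => i _; rewrite sqr_ge0. Qed.

Lemma L1_quad : L1 P (fun w => quad (V w)).
Proof. by apply: L1_sum => i; exact: L1_dot_pow. Qed.

Lemma mean_quad : mean P (fun w => quad (V w)) = A / q%:R.
Proof.
rewrite mean_sum; last by move=> i; exact: L1_dot_pow.
by rewrite mulr_suml; apply: eq_bigr => i _; exact: mean_dot_sqr.
Qed.

(** Jensen's inequality with weights [sqnorm (S i)] bounds the square of the
    form by fourth powers of single projections; the result is uniform over the
    forms of trace [A], spiked ones included. *)
Lemma mean_quad_sqr : L1 P (fun w => quad (V w) ^+ 2) /\
  mean P (fun w => quad (V w) ^+ 2) <= 9 * sphere_c4 * (A / q%:R) ^+ 2.
Proof.
have A0 : 0 <= A by apply: sumr_ge0 => i _; exact: sqnorm_ge0.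
pose F w := A * \sum_(i < m) (sqnorm (S i))^-1 * dot (S i) (U w) ^+ 4.
have le w : quad (V w) ^+ 2 <= F w.
  have E i : dot (S i) (U w) ^+ 2 =
      sqnorm (S i) * (dot (S i) (U w) ^+ 2 / sqnorm (S i)).
    have [S0|S0] := eqVneq (sqnorm (S i)) 0; last by rewrite mulrC divfK.
    rewrite S0 mul0r /dot big1 ?expr0n// => k _.
    have /eqP : S i k ^+ 2 = 0.
      by apply: (psumr_eq0P _ S0) => // j _; exact: sqr_ge0.
    by rewrite sqrf_eq0 => /eqP ->; rewrite mul0r.
  rewrite /quad (eq_bigr _ (fun i _ => E i)).
  apply: le_trans (sqr_sum_weighted _ _) _ => [i|]; first exact: sqnorm_ge0.
  rewrite ler_wpM2l//; apply: ler_sum => i _.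
  have [S0|S0] := eqVneq (sqnorm (S i)) 0; first by rewrite S0 invr0 !mul0r.
  by rewrite le_eqVlt; apply/orP; left; apply/eqP; field.
have FL : L1 P F.
  by apply: L1Z; apply: L1_sum => i; apply: L1Z; exact: L1_dot_pow.
have QL : L1 P (fun w => quad (V w) ^+ 2).
  apply: (L1_le _ _ FL).
    by apply: measurable_funX; exact: (vmeas_vec gX vmeas_quad).
  by move=> w; rewrite ger0_norm ?sqr_ge0.
split=> //; apply: le_trans (mean_le QL FL le) _.
rewrite meanZ; last by apply: L1_sum => i; apply: L1Z; exact: L1_dot_pow.
have -> : 9 * sphere_c4 * (A / q%:R) ^+ 2 =
    A * \sum_(i < m) (9 * sphere_c4 / q%:R ^+ 2) * sqnorm (S i).
  by rewrite -mulr_sumr -/A; field; rewrite pnatr_eq0 -lt0n.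
rewrite ler_wpM2l// mean_sum; last by move=> i; apply: L1Z; exact: L1_dot_pow.
apply: ler_sum => i _; rewrite meanZ; last exact: L1_dot_pow.
have [S0|S0] := eqVneq (sqnorm (S i)) 0; first by rewrite S0 invr0 mul0r mulr0.
have Sp : 0 < sqnorm (S i) by rewrite lt_neqAle eq_sym S0 sqnorm_ge0.
rewrite mulrC ler_pdivrMr//; apply: le_trans (mean_dot_pow4 gX q0 (S i)) _.
by rewrite le_eqVlt; apply/orP; left; apply/eqP; field; rewrite pnatr_eq0 -lt0n.
Qed.

End ProjectionMoments.

(** * Deterministic bounds for roots of Huber equations *)

Section Huber.
Context {R : realType}.
Implicit Types H x a : R.

Lemma huber_cases H x : 0 <= H ->
  [\/ x <= - H /\ huber H x = - H, - H <= x <= H /\ huber H x = x |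
      H <= x /\ huber H x = H].
Proof.
move=> H0; rewrite /huber; case: (leP x (- H)) => [xH|/ltW xH].
  by constructor 1; split=> //; rewrite min_r//; lra.
case: (leP H x) => xH'; first by constructor 3.
by constructor 2; split=> //; rewrite xH ltW.
Qed.

Lemma huber_norm_le H x : 0 <= H -> `|huber H x| <= H.
Proof. by move=> H0; case: (huber_cases x H0) => -[h ->]; rewrite ler_norml; lra. Qed.

Lemma huber_norm_leid H x : 0 <= H -> `|huber H x| <= `|x|.
Proof.
move=> H0; case: (huber_cases x H0) => -[h ->]//; rewrite ler_norml;
  case: (ger0P x) => x0; lra.
Qed.

Lemma huberN H x : 0 <= H -> huber H (- x) = - huber H x.
Proof.
move=> H0.
case: (huber_cases x H0) => -[h ->]; case: (huber_cases (- x) H0) => -[h' ->]; lra.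
Qed.

Lemma huber_lipschitz H x y : 0 <= H -> `|huber H x - huber H y| <= `|x - y|.
Proof.
move=> H0.
case: (huber_cases x H0) => -[h ->]; case: (huber_cases y H0) => -[h' ->];
  rewrite ler_norml; case: (ger0P (x - y)) => xy; lra.
Qed.

Lemma measurable_huber H : measurable_fun setT (huber H).
Proof. by apply: measurable_minr => //; exact: measurable_maxr. Qed.

(** An observation with [`|x| <= H / 2] loses at least [Num.min a (H / 2)] of
    score when the centre moves by [a]; the factor [H - 2 * `|x|] is nonpositive
    for the others, which makes the bound hold for every [x] and summable. *)
Lemma huber_drop H x a : 0 < H -> 0 <= a ->
  Num.min a (H / 2) * (H - 2 * `|x|) <= H * (huber H x - huber H (x - a)).
Proof.
move=> H0 a0; set m := Num.min a (H / 2).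
have m0 : 0 <= m by rewrite le_min; lra.
have H0' := ltW H0.
have mon : huber H (x - a) <= huber H x.
  by case: (huber_cases x H0') => -[h ->];
    case: (huber_cases (x - a) H0') => -[h' ->]; lra.
have [xH|xH] := leP (H / 2) `|x|.
  apply: (@le_trans _ _ 0); first by rewrite mulr_ge0_le0//; lra.
  by rewrite mulr_ge0// subr_ge0.
have drop : m <= huber H x - huber H (x - a).
  move: xH; rewrite ltr_norml => /andP[x1 x2].
  rewrite /m ge_min; have [aH|aH] := leP a (H / 2); apply/orP; [left|right];
    by case: (huber_cases x H0') => -[h ->];
    case: (huber_cases (x - a) H0') => -[h' ->]; lra.
apply: (@le_trans _ _ (H * m)); last by rewrite ler_wpM2l.
by rewrite mulrC ler_wpM2r//; have := normr_ge0 x; lra.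
Qed.

Variables (n : nat) (x : 'I_n -> R) (a H : R).
Hypotheses (n0 : (0 < n)%N) (H0 : 0 < H).

Let n1 : 0 < n%:R :> R. Proof. by rewrite ltr0n. Qed.

Let huber_root_near_ge0 (y : 'I_n -> R) b : 0 <= b ->
  \sum_(t < n) huber H (y t - b) = 0 ->
  \sum_(t < n) `|y t| <= n%:R * (H / 8) ->
  n%:R * b <= 2 * \sum_(t < n) huber H (y t).
Proof.
move=> b0 root small; set p := \sum_(t < n) huber H (y t).
set s := \sum_(t < n) `|y t| in small.
have ps : p <= s.
  apply: ler_sum => t _; apply: le_trans (huber_norm_leid _ (ltW H0)).
  exact: ler_norm.
have : \sum_(t < n) Num.min b (H / 2) * (H - 2 * `|y t|) <=
    \sum_(t < n) H * (huber H (y t) - huber H (y t - b)).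
  by apply: ler_sum => t _; exact: huber_drop.
rewrite -!mulr_sumr !sumrB sumr_const card_ord root subr0 -/p -mulr_sumr -/s.
rewrite -[H *+ n]mulr_natl; set m := Num.min b (H / 2) => h.
have m0 : 0 <= m by rewrite le_min b0 divr_ge0// ltW.
have mp : n%:R * m * (3 / 4) <= p.
  rewrite -(ler_pM2l H0); apply: le_trans h.
  have -> : H * (n%:R * m * (3 / 4)) = m * (3 / 4 * (n%:R * H)) by ring.
  by rewrite ler_wpM2l//; lra.
have mH : m <= H / 6 by rewrite -(ler_pM2l n1); lra.
have mb : m = b.
  move: mH; rewrite /m; case: (leP b (H / 2)) => // _ mH.
  by have := H0; lra.
by move: mp; rewrite mb; have := mulr_ge0 (ltW n1) b0; lra.
Qed.

Hypothesis root : \sum_(t < n) huber H (x t - a) = 0.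

Let rootN : \sum_(t < n) huber H (- x t - (- a)) = 0.
Proof.
transitivity (- \sum_(t < n) huber H (x t - a)); last by rewrite root oppr0.
rewrite -sumrN; apply: eq_bigr => t _.
by rewrite -opprD huberN// ltW.
Qed.

(** Moving the centre by [a] moves the sum of scores by a multiple of [a] as
    long as most observations stay in the linear part. *)
Lemma huber_root_near : \sum_(t < n) `|x t| <= n%:R * (H / 8) ->
  n%:R * `|a| <= 2 * `|\sum_(t < n) huber H (x t)|.
Proof.
move=> small; case: (ger0P a) => a0.
  apply: le_trans (huber_root_near_ge0 _ root small) _ => //.
  by rewrite ler_wpM2l// ler_norm.
have a0' : 0 <= - a by lra.
have small' : \sum_(t < n) `|- x t| <= n%:R * (H / 8).
  by under eq_bigr do rewrite normrN.
rewrite -[X in _ <= 2 * X]normrN -sumrN.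
apply: le_trans (huber_root_near_ge0 a0' rootN small') _.
rewrite ler_wpM2l// (eq_bigr (fun t => - huber H (x t))); last first.
  by move=> t _; rewrite huberN// ltW.
exact: ler_norm.
Qed.

Let huber_root_far_ge0 (y : 'I_n -> R) b : 0 <= b ->
  \sum_(t < n) huber H (y t - b) = 0 ->
  n%:R * b <= 2 * (n%:R * H) + 4 * \sum_(t < n) `|y t|.
Proof.
move=> b0 ry; set s := \sum_(t < n) `|y t|.
have s0 : 0 <= s by exact: sumr_ge0.
have nH := mulr_gt0 n1 H0.
have [bH|bH] := leP b (2 * H).
  by have := ler_wpM2l (ltW n1) bH; lra.
have pt t : b * huber H (y t - b) <= H * (4 * `|y t| - b).
  have H0' := ltW H0; have y1 := ler_norm (y t); have y0 := normr_ge0 (y t).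
  have [yb|yb] := leP (y t) (b / 2).
    case: (huber_cases (y t - b) H0') => -[h ->]; [|lra|lra].
    by have := mulr_ge0 H0' y0; lra.
  apply: (@le_trans _ _ (b * H)).
    apply: ler_wpM2l => //.
    by apply: le_trans (huber_norm_le (y t - b) H0'); exact: ler_norm.
  by rewrite mulrC ler_wpM2l//; lra.
have : \sum_(t < n) b * huber H (y t - b) <=
    \sum_(t < n) H * (4 * `|y t| - b).
  by apply: ler_sum => t _; exact: pt.
rewrite -!mulr_sumr ry mulr0 sumrB sumr_const card_ord -mulr_sumr -/s.
by rewrite pmulr_rge0// -[b *+ n]mulr_natl; lra.
Qed.

(** If [a] exceeds [2 * H], every observation below [a / 2] scores [- H], so the
    equation forces the sum of the [`|x t|] to be at least [n * a / 4]. *)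
Lemma huber_root_far :
  n%:R * `|a| <= 2 * (n%:R * H) + 4 * \sum_(t < n) `|x t|.
Proof.
case: (ger0P a) => a0; first exact: huber_root_far_ge0.
have a0' : 0 <= - a by lra.
have := huber_root_far_ge0 a0' rootN.
by under eq_bigr do rewrite normrN.
Qed.

(** When the sum of the [`|x t|] is too large for [huber_root_near], its
    distance to [M] is itself of order [n * H]. *)
Lemma huber_root_le M : M <= n%:R * (H / 16) ->
  n%:R * `|a| <= 2 * `|\sum_(t < n) huber H (x t)| +
    40 * `|\sum_(t < n) `|x t| - M|.
Proof.
move=> MH; set D := `|_ - M|; have D0 : 0 <= D by exact: normr_ge0.
have [small|large] := leP (\sum_(t < n) `|x t|) (n%:R * (H / 8)).
  by have := huber_root_near small; lra.
(* Here [D] is at least half the sum, hence at least [n * H / 16]. *)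
have p0 := normr_ge0 (\sum_(t < n) huber H (x t)).
have DE : \sum_(t < n) `|x t| - M <= D by exact: ler_norm.
by have := huber_root_far; lra.
Qed.

End Huber.

(** * Mean squared errors of Huber scores *)

Section HuberMoments.
Context {d : measure_display} {T : measurableType d} {R : realType}.
Variable P : probability T R.
Context {n : nat}.
Hypothesis n0 : (0 < n)%N.

Let n1 : 0 < n%:R :> R. Proof. by rewrite ltr0n. Qed.

(** By [huber_root_le] the squared error is at most a multiple of the squared
    mean score and of the squared fluctuation of the mean of the [`|x t|]. Both
    are centred averages of pairwise independent variables, and as
    [`|huber H x| <= `|x|] both are controlled by second moments of the [x t],
    uniformly in [H]. *)
Lemma huber_location_mse (x : 'I_n -> T -> R) (a : T -> R) (H B : R) :
  (forall t, measurable_fun setT (x t)) -> measurable_fun setT a ->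
  (forall t, L1 P (fun w => x t w ^+ 2)) ->
  (forall t, mean P (fun w => x t w ^+ 2) <= B) ->
  (forall s t, s != t -> indep_rv P (x s) (x t)) ->
  (forall t, mean P (fun w => huber H (x t w)) = 0) ->
  (forall w, \sum_(t < n) huber H (x t w - a w) = 0) ->
  16 * (1 + B) <= H ->
  L1 P (fun w => a w ^+ 2) /\ mean P (fun w => a w ^+ 2) <= 3208 * B / n%:R.
Proof.
move=> mx ma x2 xB xind hub0 root HB.
have B0 : 0 <= B.
  by apply: le_trans (xB (Ordinal n0)); apply: mean_ge0 => w; exact: sqr_ge0.
have H0 : 0 < H by lra.
have x1 t : L1 P (x t) by exact: L1_of_sqr.
have mh := measurable_huber H.
have mabs : measurable_fun setT (fun y : R => `|y|) by exact: normr_measurable.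
pose h t w := huber H (x t w); pose z t w := `|x t w|.
have mht t : measurable_fun setT (h t) by apply: measurableT_comp.
have mzt t : measurable_fun setT (z t) by apply: measurableT_comp.
have h2 t w : h t w ^+ 2 <= x t w ^+ 2.
  rewrite -[leLHS]real_normK ?num_real// -[leRHS]real_normK ?num_real//.
  by apply: lerXn2r; rewrite ?nnegrE// huber_norm_leid// ltW.
have h2L t : L1 P (fun w => h t w ^+ 2).
  apply: (L1_le _ _ (x2 t)); first exact: measurable_funX.
  by move=> w; rewrite ger0_norm ?sqr_ge0.
have z2E t : (fun w => z t w ^+ 2) = (fun w => x t w ^+ 2).
  by apply/funext => w; rewrite real_normK ?num_real.
have z2L t : L1 P (fun w => z t w ^+ 2) by rewrite z2E.
have [GL Gle] := variance_sum_le (fun=> 0) mht h2L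
  (fun s t st => indep_rv_comp mh mh (xind s t st)).
have [DL Dle] := variance_sum_le (fun=> 0) mzt z2L
  (fun s t st => indep_rv_comp mabs mabs (xind s t st)).
set M := \sum_(t < n) mean P (z t) in DL Dle.
have sum0 : \sum_(t < n) mean P (h t) = 0.
  by rewrite big1// => t _; exact: hub0.
rewrite sum0 in GL Gle.
have nB (F : 'I_n -> R) : (forall t, F t <= B) -> \sum_(t < n) F t <= n%:R * B.
  move=> FB; apply: (@le_trans _ _ (\sum_(t < n) B)); first exact: ler_sum.
  by rewrite sumr_const card_ord mulr_natl.
have sub0 (f : T -> R) : (fun w => (f w - 0) ^+ 2) = (fun w => f w ^+ 2).
  by apply/funext => w; rewrite subr0.
have hB t : mean P (fun w => (h t w - 0) ^+ 2) <= B.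
  by rewrite sub0; apply: le_trans (xB t); exact: mean_le.
have zB t : mean P (fun w => (z t w - 0) ^+ 2) <= B by rewrite sub0 z2E.
have {}Gle := le_trans Gle (nB _ hB).
have {}Dle := le_trans Dle (nB _ zB).
have MH : M <= n%:R * (H / 16).
  apply: (@le_trans _ _ (\sum_(t < n) (1 + B))).
    apply: ler_sum => t _.
    apply: (@le_trans _ _ (mean P (fun w => 1 + x t w ^+ 2))).
      apply: mean_le => [||w]; [exact: L1_norm|by apply: L1D; [exact: L1_cst|]|].
      rewrite /z -[x t w ^+ 2]real_normK ?num_real//.
      by have := sqr_ge0 (`|x t w| - 1); have := normr_ge0 (x t w); nra.
    by rewrite meanD ?mean_cst; [rewrite lerD2l|exact: L1_cst|].
  rewrite sumr_const card_ord -(mulr_natl (1 + B)) ler_wpM2l ?(ltW n1)//; lra.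
pose F w := 8 * (\sum_(t < n) h t w - 0) ^+ 2 +
  3200 * (\sum_(t < n) z t w - M) ^+ 2.
have FL : L1 P F by apply: L1D; exact: L1Z.
have le w : a w ^+ 2 <= (n%:R ^+ 2)^-1 * F w.
  rewrite mulrC ler_pdivlMr ?exprn_gt0// -exprMn mulrC.
  rewrite -[leLHS]real_normK ?num_real// normrM (ger0_norm (ltW n1)).
  have := huber_root_le n0 H0 (root w) MH.
  rewrite /F subr0 -[(\sum_t h t w) ^+ 2]real_normK ?num_real//.
  rewrite -[(_ - M) ^+ 2]real_normK ?num_real//.
  set g := `|\sum_(t < n) huber H (x t w)|; set D := `|_ - M|.
  move=> le; apply: (@le_trans _ _ ((2 * g + 40 * D) ^+ 2)).
    have g0 : 0 <= g by exact: normr_ge0.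
    have D0 : 0 <= D by exact: normr_ge0.
    apply: lerXn2r => //; rewrite nnegrE; first by rewrite mulr_ge0// ltW.
    by rewrite addr_ge0 ?mulr_ge0.
  by have := sqr_ge0 (2 * g - 40 * D); rewrite !sqrrD sqrrN; lra.
have aL : L1 P (fun w => a w ^+ 2).
  apply: (L1_le _ _ (L1Z (n%:R ^+ 2)^-1 FL)); first exact: measurable_funX.
  by move=> w; rewrite ger0_norm ?sqr_ge0.
split=> //; apply: le_trans (mean_le aL (L1Z _ FL) le) _.
rewrite meanZ// meanD; [|exact: L1Z|exact: L1Z].
rewrite !meanZ// mulrC ler_pdivrMr ?exprn_gt0//.
have -> : 3208 * B / n%:R * n%:R ^+ 2 = 8 * (n%:R * B) + 3200 * (n%:R * B).
  by field; rewrite gt_eqF.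
apply: lerD; first exact: ler_wpM2l (ler0n R 8) _ _ Gle.
exact: ler_wpM2l (ler0n R _) _ _ Dle.
Qed.

Lemma huber_sqr_le (r H y : R) : 1 <= r <= 2 -> 0 < H ->
  huber H y ^+ 2 <= `|y| `^ r * H `^ (2 - r).
Proof.
move=> /andP[r1 r2] H0.
have -> : huber H y ^+ 2 = `|huber H y| `^ r * `|huber H y| `^ (2 - r).
  rewrite -powRD; last by apply/implyP; rewrite addrCA subrr addr0 pnatr_eq0.
  by rewrite addrCA subrr addr0 powR_mulrn// real_normK ?num_real.
apply: ler_pM; rewrite ?powR_ge0//.
  by apply: ge0_ler_powR; rewrite ?nnegrE//; [lra|exact: huber_norm_leid (ltW _)].
apply: ge0_ler_powR; rewrite ?nnegrE ?(ltW H0)//; first lra.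
exact: huber_norm_le (ltW _).
Qed.

Lemma huber_bias_le (r H y : R) : 1 <= r <= 2 -> 0 < H ->
  `|huber H y - y| <= `|y| `^ r * H `^ (1 - r).
Proof.
move=> /andP[r1 r2] H0; have [yH|Hy] := leP `|y| H.
  have -> : huber H y = y.
    move: yH; rewrite ler_norml => yH.
    by case: (huber_cases y (ltW H0)) => -[h ->]; lra.
  by rewrite subrr normr0 mulr_ge0 ?powR_ge0.
apply: (@le_trans _ _ `|y|).
  case: (huber_cases y (ltW H0)) => -[h ->]; move: Hy; case: (ger0P y) => y0 Hy;
    rewrite ler_norml; lra.
have Hr : 0 < H `^ (r - 1) by exact: powR_gt0.
rewrite -mulr_powRB1//; last lra.
rewrite -(opprB r 1) powRN ler_pdivlMr// ler_wpM2l//.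
by apply: ge0_ler_powR; rewrite ?nnegrE ?(ltW H0) ?(ltW Hy)//; lra.
Qed.

(** The score at the true centre: truncation at [H] trades the bias
    [m * H ^ (1 - r)] against the variance [m * H ^ (2 - r) / n]. *)
Lemma huber_score_mse (Y : 'I_n -> T -> R) (H r m : R) :
  1 <= r <= 2 -> 0 < H ->
  (forall t, L1 P (Y t)) -> (forall t, mean P (Y t) = 0) ->
  (forall t, L1 P (fun w => `|Y t w| `^ r)) ->
  (forall t, mean P (fun w => `|Y t w| `^ r) <= m) ->
  (forall s t, s != t -> indep_rv P (Y s) (Y t)) ->
  L1 P (fun w => (\sum_(t < n) huber H (Y t w)) ^+ 2) /\
  mean P (fun w => (\sum_(t < n) huber H (Y t w)) ^+ 2) <=
    2 * (n%:R * (m * H `^ (2 - r))) + 2 * (n%:R * (m * H `^ (1 - r))) ^+ 2.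
Proof.
move=> r12 H0 Y1 Y0 YrL Yr Yind.
have mh := measurable_huber H.
pose h t w := huber H (Y t w).
have mht t : measurable_fun setT (h t).
  by apply: measurableT_comp => //; exact: L1_measurable (Y1 t).
have hL t : L1 P (h t).
  by apply: (@L1_bounded _ _ _ P _ H) => // w; exact: huber_norm_le (ltW _).
have h2L t : L1 P (fun w => h t w ^+ 2).
  apply: (@L1_bounded _ _ _ P _ (H ^+ 2)); first exact: measurable_funX.
  move=> w; rewrite normrX; apply: lerXn2r; rewrite ?nnegrE ?(ltW H0)//.
  exact: huber_norm_le (ltW H0).
have [GL Gle] := variance_sum_le (fun=> 0) mht h2L
  (fun s t st => indep_rv_comp mh mh (Yind s t st)).
set M := \sum_(t < n) mean P (h t) in GL Gle.
have m0 : 0 <= m.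
  by apply: le_trans (Yr (Ordinal n0)); apply: mean_ge0 => w; exact: powR_ge0.
have MB : `|M| <= n%:R * (m * H `^ (1 - r)).
  apply: (le_trans (ler_norm_sum _ _ _)).
  apply: (@le_trans _ _ (\sum_(t < n) m * H `^ (1 - r))); last first.
    by rewrite sumr_const card_ord mulr_natl.
  apply: ler_sum => t _.
  have -> : mean P (h t) = mean P (fun w => h t w - Y t w).
    by rewrite meanB// Y0 subr0.
  have dL : L1 P (fun w => h t w - Y t w) by exact: L1B.
  apply: le_trans (norm_mean_le dL) _.
  apply: (@le_trans _ _ (H `^ (1 - r) * mean P (fun w => `|Y t w| `^ r))).
    rewrite -meanZ//; apply: mean_le => [||w]; [exact: L1_norm|exact: L1Z|].
    by rewrite mulrC; exact: huber_bias_le.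
  by rewrite mulrC ler_wpM2r ?powR_ge0.
have VB : \sum_(t < n) mean P (fun w => (h t w - 0) ^+ 2) <=
    n%:R * (m * H `^ (2 - r)).
  apply: (@le_trans _ _ (\sum_(t < n) m * H `^ (2 - r))); last first.
    by rewrite sumr_const card_ord mulr_natl.
  apply: ler_sum => t _; under [fun w => _]funext do rewrite subr0.
  apply: (@le_trans _ _ (H `^ (2 - r) * mean P (fun w => `|Y t w| `^ r))).
    rewrite -meanZ//; apply: mean_le => [||w] //; first exact: L1Z.
    by rewrite mulrC; exact: huber_sqr_le.
  by rewrite mulrC ler_wpM2r ?powR_ge0.
have SL : L1 P (fun w => (\sum_(t < n) h t w) ^+ 2).
  have mS : measurable_fun setT (fun w => \sum_(t < n) h t w - M).
    by apply: measurable_funB => //; exact: measurable_sum.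
  have := L1_sqrD mS (g := fun=> M) (measurable_cst _) GL (L1_cst P _).
  by under [fun w => _]funext do rewrite subrK.
split=> //.
apply: (@le_trans _ _ (mean P (fun w =>
    2 * (\sum_(t < n) h t w - M) ^+ 2 + 2 * M ^+ 2))).
  apply: mean_le => [||w] //; first by apply: L1D; [exact: L1Z|exact: L1_cst].
  set s := \sum_(t < n) h t w.
  have := sqr_ge0 (s - 2 * M).
  have -> : (s - 2 * M) ^+ 2 = 2 * (s - M) ^+ 2 + 2 * M ^+ 2 - s ^+ 2 by ring.
  by rewrite subr_ge0.
rewrite meanD ?meanZ ?mean_cst//; do ?[exact: L1_cst|exact: L1Z].
apply: lerD; rewrite ler_wpM2l//; first exact: le_trans Gle VB.
rewrite -[leLHS]real_normK ?num_real//.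
by apply: lerXn2r; rewrite ?nnegrE ?mulr_ge0 ?powR_ge0 ?(ltW n1).
Qed.

End HuberMoments.

(** * One sample of the elliptical model *)

(** The cross terms are split by [2 * x * a <= V * x ^+ 2 + a ^+ 2 / V], with [V]
    the root mean square of the [a i]. *)
Lemma norm2_perturb_le {R : rcfType} (q : nat) (x a : 'I_q -> R)
    (X V : R) : (0 < q)%N ->
  X = (\sum_(i < q) x i ^+ 2) / q%:R ->
  V = Num.sqrt ((\sum_(i < q) a i ^+ 2) / q%:R) ->
  `|(\sum_(i < q) (x i - a i) ^+ 2) / q%:R - X| <= V * (1 + X) + V ^+ 2.
Proof.
move=> q0 XE VE; have q1 : 0 < q%:R :> R by rewrite ltr0n.
have A0 : 0 <= \sum_(i < q) a i ^+ 2 by apply: sumr_ge0 => i _; exact: sqr_ge0.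
have V0 : 0 <= V by rewrite VE sqrtr_ge0.
have V2 : V ^+ 2 = (\sum_(i < q) a i ^+ 2) / q%:R.
  by rewrite VE sqr_sqrtr// divr_ge0// ltW.
have -> : (\sum_(i < q) (x i - a i) ^+ 2) / q%:R - X =
    V ^+ 2 - 2 * (\sum_(i < q) x i * a i) / q%:R.
  rewrite XE V2 -!mulrBl; congr (_ / _).
  by rewrite mulr_sumr -!sumrB; apply: eq_bigr => i _; ring.
apply: le_trans (ler_normB _ _) _; rewrite (ger0_norm (sqr_ge0 V)) addrC lerD2r.
rewrite normrM (ger0_norm (x := q%:R^-1)) ?invr_ge0 ?(ltW q1)// ler_pdivrMr//.
have -> : V * (1 + X) * q%:R = V * q%:R + V * (\sum_(i < q) x i ^+ 2).
  by rewrite XE; field; rewrite gt_eqF.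
have [V00|Vn0] := eqVneq V 0.
  have a0 i : a i = 0.
    have Aq : \sum_(i < q) a i ^+ 2 = 0.
      move/eqP: V2; rewrite V00 expr0n eq_sym mulf_eq0 invr_eq0 (gt_eqF q1).
      by rewrite orbF => /eqP.
    apply/eqP; rewrite -sqrf_eq0; apply/eqP.
    by apply: (psumr_eq0P _ Aq) => // j _; exact: sqr_ge0.
  by rewrite V00 !mul0r addr0 big1 ?mulr0 ?normr0// => i _; rewrite a0 mulr0.
have Vp : 0 < V by rewrite lt_neqAle eq_sym Vn0.
have -> : V * q%:R = V^-1 * \sum_(i < q) a i ^+ 2.
  have -> : \sum_(i < q) a i ^+ 2 = V ^+ 2 * q%:R by rewrite V2 divfK// gt_eqF.
  by field.
rewrite normrM normr_nat; apply: le_trans (ler_wpM2l _ (ler_norm_sum _ _ _)) _ => //.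
rewrite !mulr_sumr -big_split /=; apply: ler_sum => i _.
rewrite normrM -[x i ^+ 2]real_normK ?num_real// -[a i ^+ 2]real_normK ?num_real//.
set y := `|x i|; set b := `|a i|.
rewrite -(ler_pM2l Vp) mulrDr (mulVKf Vn0).
by have := sqr_ge0 (V * y - b); rewrite sqrrB; lra.
Qed.

Section Sample.
Context {d : measure_display} {T : measurableType d} {R : realType}.
Variable P : probability T R.
Context {n q : nat}.
Hypotheses (n0 : (0 < n)%N) (q0 : (0 < q)%N).
Variables (mu : 'cV[R]_q) (Sig S : 'M[R]_q).
Hypothesis hS : psd_sqrt_of Sig S.
Hypothesis htr : \tr Sig = q%:R.
Variable xi : 'I_n -> {RV P >-> R}.
Hypothesis hxi : forall t w, 0 <= xi t w.
Variable z : 'I_n -> 'I_q -> {RV P >-> R}.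
Hypothesis hz : iid_standard_gaussian_vectors z.
Hypothesis ixi : mutually_independent P (fun t => xi t : T -> R).
Hypothesis ixiu : independent_families P (fun t => xi t : T -> R)
  (fun (ti : 'I_n * 'I_q) w => direction (z ti.1) w ti.2 ord0).

Let Z t i : T -> R := z t i.
Let row_of i : 'I_q -> R := fun k => S i k.

Lemma sqnorm_row i : sqnorm (row_of i) = Sig i i.
Proof.
have [[S1 _] <-] := hS; rewrite mxE; apply: eq_bigr => k _.
by rewrite expr2 -{2}S1 mxE.
Qed.

Lemma sum_sqnorm_row : \sum_(i < q) sqnorm (row_of i) = q%:R.
Proof. by rewrite -htr; apply: eq_bigr => i _; exact: sqnorm_row. Qed.

(** The centred [i]-th coordinate of the [t]-th observation. *)
Definition dev i t w : R :=
  Num.sqrt q%:R * (xi t w * dot (row_of i) (dir (fun k => Z t k w))).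

Lemma elliptical_obsE i t w :
  elliptical_obs mu S (xi t) (z t) w i ord0 = mu i ord0 + dev i t w.
Proof.
rewrite /elliptical_obs !mxE -mulrA; congr (_ + _ * (_ * _)).
by apply: eq_bigr => k _; rewrite directionE.
Qed.

(** [||y_t - mu||^2 / q]. *)
Definition energy t w : R := xi t w ^+ 2 * quad row_of (fun k => Z t k w).

Lemma energyE t w : energy t w = (\sum_(i < q) dev i t w ^+ 2) / q%:R.
Proof.
have q1 : q%:R != 0 :> R by rewrite pnatr_eq0 -lt0n.
apply: (mulIf q1); rewrite divfK// /energy /quad mulrAC mulr_sumr.
apply: eq_bigr => i _; rewrite /dev !exprMn sqr_sqrtr//; ring.
Qed.

Let gZ t : gaussian_vec P (Z t) := iid_gaussian_vec hz t.

Let lin i (x : q.-tuple R) : R := \sum_(k < q) row_of i k * tnth x k.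

Let m_lin i : measurable_fun setT (lin i).
Proof.
by apply: measurable_sum => k; apply: measurable_funM => //; exact: measurable_tnth.
Qed.

Let D t w : q.-tuple R := dir_tuple (vec (Z t) w).

Let linE i t w : lin i (D t w) = dot (row_of i) (dir (fun k => Z t k w)).
Proof.
apply: eq_bigr => k _; rewrite tnth_mktuple; congr (_ * dir _ _).
by apply/funext => j; rewrite tnth_mktuple.
Qed.

Let sc := scale_direction_indep ixiu.
Let si := sample_indep hz ixi ixiu.

Lemma dev_indep i s t : s != t -> indep_rv P (dev i s) (dev i t).
Proof.
move=> st; pose f (p : R * q.-tuple R) := Num.sqrt q%:R * (p.1 * lin i p.2).
have mf : measurable_fun setT f.
  apply: measurable_funM => //; apply: measurable_funM => //.
  exact: measurableT_comp.
have E r : dev i r = f \o (fun w => (xi r w, D r w)).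
  by apply/funext => w; rewrite /f /= linE.
by rewrite !E; exact: indep_rv_comp (si st).
Qed.

Lemma energy_indep s t : s != t -> indep_rv P (energy s) (energy t).
Proof.
move=> st; pose f (p : R * q.-tuple R) := p.1 ^+ 2 * \sum_(i < q) lin i p.2 ^+ 2.
have mf : measurable_fun setT f.
  apply: measurable_funM; first exact: measurable_funX.
  apply: measurable_sum => i; apply: measurable_funX.
  exact: measurableT_comp.
have E r : energy r = f \o (fun w => (xi r w, D r w)).
  apply/funext => w; rewrite /f /=; congr (_ * _).
  by apply: eq_bigr => i _; rewrite linE.
by rewrite !E; exact: indep_rv_comp (si st).
Qed.

Lemma scale_fun_indep t (f : R -> R) (g : q.-tuple R -> R) :
  measurable_fun setT f -> measurable_fun setT g ->
  indep_rv P (f \o xi t) (g \o D t).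
Proof. by move=> mf mg; exact: indep_rv_comp (sc t). Qed.

Variables (Ex2 eps C : R).
Hypothesis xi2 : forall t, ('E_P[(fun w => xi t w ^+ 2)%R] = Ex2%:E)%E.
Hypothesis heps : 0 < eps < 2.
Hypothesis xiC : forall t, ('E_P[(fun w => xi t w `^ (2 + eps))%R] < C%:E)%E.

Let mxi t : measurable_fun setT (xi t).
Proof. exact: measurable_funPT. Qed.

Lemma L1_xi2 t : L1 P (fun w => xi t w ^+ 2).
Proof.
apply: L1_of_ge0 => [|w|]; [exact: measurable_funX|exact: sqr_ge0|].
by have := xi2 t; rewrite unlock => ->; rewrite ltry.
Qed.

Lemma mean_xi2 t : mean P (fun w => xi t w ^+ 2) = Ex2.
Proof.
by have := xi2 t; rewrite unlock (mean_EFin (L1_xi2 t)) => -[].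
Qed.

Lemma L1_xi_powR t : L1 P (fun w => xi t w `^ (2 + eps)).
Proof.
apply: L1_of_ge0 => [|w|]; [|exact: powR_ge0|].
  exact: (@measurableT_comp _ _ _ _ _ _ (@powR R ^~ (2 + eps))).
by have := xiC t; rewrite unlock => h; apply: lt_trans h _; rewrite ltry.
Qed.

Lemma mean_xi_powR t : mean P (fun w => xi t w `^ (2 + eps)) <= C.
Proof.
have := xiC t; rewrite unlock (mean_EFin (L1_xi_powR t)) lte_fin.
exact: ltW.
Qed.

Lemma Ex2_ge0 : 0 <= Ex2.
Proof.
by rewrite -(mean_xi2 (Ordinal n0)); apply: mean_ge0 => w; exact: sqr_ge0.
Qed.

Lemma Ex2_le : Ex2 <= 1 + C.
Proof.
rewrite -(mean_xi2 (Ordinal n0)).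
apply: (@le_trans _ _ (mean P (fun w => 1 + xi (Ordinal n0) w `^ (2 + eps)))).
  have /andP[e0 e2] := heps.
  apply: mean_le => [||w]; first exact: L1_xi2.
    by apply: L1D; [exact: L1_cst|exact: L1_xi_powR].
  have [le1|ge1] := leP (xi (Ordinal n0) w) 1.
    have := powR_ge0 (xi (Ordinal n0) w) (2 + eps).
    have : xi (Ordinal n0) w ^+ 2 <= 1 by rewrite expr_le1.
    lra.
  have : xi (Ordinal n0) w ^+ 2 <= xi (Ordinal n0) w `^ (2 + eps).
    by rewrite -powR_mulrn//; apply: ler_powR; [exact: ltW|lra].
  lra.
rewrite meanD ?mean_cst; [|exact: L1_cst|exact: L1_xi_powR].
by rewrite lerD2l mean_xi_powR.
Qed.

Lemma measurable_dev i t : measurable_fun setT (dev i t).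
Proof.
apply: measurable_funM => //; apply: measurable_funM => //.
exact: (vmeas_vec (gZ t) (vmeas_dot _)).
Qed.

Lemma mean_dev_sqr i t : L1 P (fun w => dev i t w ^+ 2) /\
  mean P (fun w => dev i t w ^+ 2) = Ex2 * Sig i i.
Proof.
have E : (fun w => dev i t w ^+ 2) = (fun w => q%:R * (xi t w ^+ 2 *
    dot (row_of i) (dir (fun k => Z t k w)) ^+ 2)).
  by apply/funext => w; rewrite /dev !exprMn sqr_sqrtr.
have ind : indep_rv P (fun w => xi t w ^+ 2)
    (fun w => dot (row_of i) (dir (fun k => Z t k w)) ^+ 2).
  have sqm : measurable_fun setT (fun y : R => y ^+ 2) by exact: measurable_funX.
  have := scale_fun_indep t sqm (measurable_funX 2 (m_lin i)).
  rewrite /comp; under [fun w => lin _ _ ^+ 2]funext do rewrite linE.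
  by [].
have [L M] := mean_mul (L1_xi2 t) (L1_dot_pow (gZ t) (row_of i) 2) ind.
rewrite E; split; first exact: L1Z.
rewrite meanZ// M mean_xi2 mean_dot_sqr// sqnorm_row.
by field; rewrite pnatr_eq0 -lt0n.
Qed.

Lemma mean_huber_dev i t (H : R) : 0 <= H ->
  mean P (fun w => huber H (dev i t w)) = 0.
Proof.
move=> H0.
pose g x := huber H (Num.sqrt q%:R * x).
apply: (mean_odd_scaled_dot (gZ t) (g := g) (c := H) (s := row_of i)) => //.
- by apply: measurableT_comp; [exact: measurable_huber|exact: measurable_funM].
- by move=> x; exact: huber_norm_le.
- by move=> x; rewrite /g mulrN huberN.
have := scale_fun_indep t (@measurable_id _ _ setT) (m_lin i).
by rewrite /comp; under [fun w => lin _ _]funext do rewrite linE.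
Qed.

Let quadD (x : q.-tuple R) : R := \sum_(i < q) lin i x ^+ 2.

Let m_quadD : measurable_fun setT quadD.
Proof.
by apply: measurable_sum => i; apply: measurable_funX; exact: m_lin.
Qed.

Let quadDE t w : quadD (D t w) = quad row_of (fun k => Z t k w).
Proof. by apply: eq_bigr => i _; rewrite linE. Qed.

Lemma energy_ge0 t w : 0 <= energy t w.
Proof. by rewrite mulr_ge0 ?sqr_ge0 ?quad_ge0. Qed.

Lemma mean_energy t : L1 P (energy t) /\ mean P (energy t) = Ex2.
Proof.
have ind : indep_rv P (fun w => xi t w ^+ 2)
    (fun w => quad row_of (fun k => Z t k w)).
  have sqm : measurable_fun setT (fun y : R => y ^+ 2) by exact: measurable_funX.
  have := scale_fun_indep t sqm m_quadD.
  by rewrite /comp; under [fun w => quadD _]funext do rewrite quadDE.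
have [L M] := mean_mul (L1_xi2 t) (L1_quad (gZ t) _) ind.
split=> //; rewrite M mean_xi2 mean_quad// sum_sqnorm_row divff ?mulr1//.
by rewrite pnatr_eq0 -lt0n.
Qed.

(** The quadratic form of the direction has bounded second moment, so the
    energy inherits the moment of order [1 + eps / 2] from the scale. *)
Lemma mean_energy_powR t : L1 P (fun w => energy t w `^ (1 + eps / 2)) /\
  mean P (fun w => energy t w `^ (1 + eps / 2)) <= C * (1 + 9 * sphere_c4).
Proof.
have /andP[e0 e2] := heps.
have mpow (y : R) : measurable_fun setT (fun x : R => x `^ y).
  exact: measurable_powR.
have qn0 : q%:R != 0 :> R by rewrite pnatr_eq0 -lt0n.
have [Q2 Q2le] := mean_quad_sqr (gZ t) q0 row_of.
rewrite sum_sqnorm_row divff// expr1n mulr1 in Q2le.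
pose F w := 1 + quad row_of (fun k => Z t k w) ^+ 2.
have FL : L1 P F by apply: L1D => //; exact: L1_cst.
have ind : indep_rv P (fun w => xi t w `^ (2 + eps)) F.
  have m1 : measurable_fun setT (fun x => 1 + quadD x ^+ 2).
    by apply: measurable_funD => //; exact: measurable_funX.
  have := scale_fun_indep t (mpow (2 + eps)) m1.
  by rewrite /comp; under [fun w => 1 + _]funext do rewrite quadDE.
have [L M] := mean_mul (L1_xi_powR t) FL ind.
have le w : energy t w `^ (1 + eps / 2) <= xi t w `^ (2 + eps) * F w.
  have Q0 : 0 <= quad row_of (fun k => Z t k w) by exact: quad_ge0.
  rewrite /energy powRM ?sqr_ge0// -powR_mulrn// -powRrM.
  have -> : 2%:R * (1 + eps / 2) = 2 + eps :> R by field.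
  rewrite ler_wpM2l ?powR_ge0// /F; set Q := quad _ _ in Q0 *.
  have [Q1|Q1] := leP Q 1.
    apply: (@le_trans _ _ (1 `^ (1 + eps / 2))).
      by apply: ge0_ler_powR; rewrite ?nnegrE//; lra.
    by rewrite powR1 lerDl sqr_ge0.
  apply: (@le_trans _ _ (Q `^ 2)).
    by apply: ler_powR; [exact: ltW|lra].
  by rewrite powR_mulrn// lerDr.
have EL : L1 P (fun w => energy t w `^ (1 + eps / 2)).
  apply: (L1_le _ _ L).
    apply: (@measurableT_comp _ _ _ _ _ _ (@powR R ^~ (1 + eps / 2))) => //.
    exact: L1_measurable (mean_energy t).1.
  by move=> w; rewrite ger0_norm ?powR_ge0.
split=> //; apply: le_trans (mean_le EL L le) _; rewrite M.
apply: ler_pM.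
- by apply: mean_ge0 => w; exact: powR_ge0.
- by apply: mean_ge0 => w; rewrite addr_ge0 ?sqr_ge0.
- exact: mean_xi_powR.
- by rewrite meanD ?mean_cst ?lerD2l//; exact: L1_cst.
Qed.


Let C0 : 0 <= C.
Proof.
apply: le_trans (mean_xi_powR (Ordinal n0)).
by apply: mean_ge0 => w; exact: powR_ge0.
Qed.

(** Bounds the mean of [`|energy t w - Ex2| `^ (1 + eps / 2)]. *)
Definition energy_moment : R := C * (1 + 9 * sphere_c4) + (1 + C) ^+ 2.

Lemma energy_score_mse (H' : R) : 0 < H' ->
  L1 P (fun w => (\sum_(t < n) huber H' (energy t w - Ex2)) ^+ 2) /\
  mean P (fun w => (\sum_(t < n) huber H' (energy t w - Ex2)) ^+ 2) <=
  2 * (n%:R * (energy_moment * H' `^ (2 - (1 + eps / 2)))) +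
  2 * (n%:R * (energy_moment * H' `^ (1 - (1 + eps / 2)))) ^+ 2.
Proof.
have /andP[e0 e2] := heps.
move=> H0; set r := 1 + eps / 2.
have r12 : 1 <= r <= 2 by rewrite /r; apply/andP; split; lra.
have sub_meas : measurable_fun setT (fun y : R => y - Ex2).
  exact: measurable_funB.
have YL t : L1 P (fun w => energy t w - Ex2).
  by apply: L1B; [exact: (mean_energy t).1|exact: L1_cst].
have le t w : `|energy t w - Ex2| `^ r <= energy t w `^ r + Ex2 `^ r.
  have X0 := energy_ge0 t w; have E0 := Ex2_ge0.
  have [XE|XE] := leP Ex2 (energy t w).
    apply: (@le_trans _ _ (energy t w `^ r)); last by rewrite lerDl powR_ge0.
    by apply: ge0_ler_powR; rewrite ?nnegrE ?ger0_norm ?subr_ge0//; rewrite ?/r; lra.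
  apply: (@le_trans _ _ (Ex2 `^ r)); last by rewrite lerDr powR_ge0.
  by apply: ge0_ler_powR; rewrite ?nnegrE ?ltr0_norm ?subr_lt0//; rewrite ?/r; lra.
have YrL t : L1 P (fun w => `|energy t w - Ex2| `^ r).
  apply: (L1_le _ _ (L1D (mean_energy_powR t).1 (L1_cst P (Ex2 `^ r)))).
    apply: (@measurableT_comp _ _ _ _ _ _ (@powR R ^~ r)) => //.
    by apply: measurableT_comp => //; exact: L1_measurable (YL t).
  by move=> w; rewrite ger0_norm ?powR_ge0.
apply: (huber_score_mse n0 r12 H0 YL _ YrL).
- move=> t; rewrite meanB ?mean_cst; [|exact: (mean_energy t).1|exact: L1_cst].
  by rewrite (mean_energy t).2 subrr.
- move=> t.
  apply: le_trans (mean_le (YrL t) (L1D (mean_energy_powR t).1 (L1_cst P _)) (le t)) _.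
  rewrite meanD ?mean_cst; [|exact: (mean_energy_powR t).1|exact: L1_cst].
  apply: lerD; first exact: (mean_energy_powR t).2.
  apply: (@le_trans _ _ ((1 + C) `^ r)).
    apply: ge0_ler_powR; rewrite ?nnegrE ?Ex2_ge0 ?Ex2_le//; last exact: addr_ge0.
    by rewrite /r; lra.
  rewrite -powR_mulrn; last exact: addr_ge0.
  by apply: ler_powR; [rewrite lerDl|have /andP[] := r12].
by move=> s t st; exact: (indep_rv_comp sub_meas sub_meas (energy_indep st)).
Qed.

Variables (H Cs : R) (muhat : 'I_q -> {RV P >-> R}).
Hypothesis SigC : forall i, Sig i i <= Cs.
Hypothesis hmuhat : forall i w, \sum_(t < n) huber H
  (elliptical_obs mu S (xi t) (z t) w i ord0 - muhat i w) = 0.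

Let a i w : R := muhat i w - mu i ord0.

Definition location_err w : R := (\sum_(i < q) a i w ^+ 2) / q%:R.

Definition dev_bound : R := (1 + C) * Cs.

Lemma location_err_ge0 w : 0 <= location_err w.
Proof. by rewrite divr_ge0// sumr_ge0// => i _; rewrite sqr_ge0. Qed.

Lemma mean_location_err : 16 * (1 + dev_bound) <= H ->
  L1 P location_err /\ mean P location_err <= 3208 * dev_bound / n%:R.
Proof.
move=> HB.
have Cs0 : 0 <= Cs.
  apply: le_trans (SigC (Ordinal q0)); rewrite -sqnorm_row; exact: sqnorm_ge0.
have B0 : 0 <= dev_bound by rewrite mulr_ge0// addr_ge0.
have H0 : 0 <= H by lra.
have E i : L1 P (fun w => a i w ^+ 2) /\
    mean P (fun w => a i w ^+ 2) <= 3208 * dev_bound / n%:R.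
  apply: (huber_location_mse n0 (x := dev i) (H := H)) => //.
  - by move=> t; exact: measurable_dev.
  - by apply: measurable_funB => //; exact: measurable_funPT.
  - by move=> t; exact: (mean_dev_sqr i t).1.
  - move=> t; rewrite (mean_dev_sqr i t).2; apply: ler_pM => //.
    + exact: Ex2_ge0.
    + by rewrite -sqnorm_row sqnorm_ge0.
    + exact: Ex2_le.
  - by move=> s t st; exact: dev_indep.
  - by move=> t; exact: mean_huber_dev.
  - move=> w; rewrite -[RHS](hmuhat i w); apply: eq_bigr => t _; congr huber.
    by rewrite elliptical_obsE /a; ring.
have qp : 0 < q%:R :> R by rewrite ltr0n.
have SL : L1 P (fun w => \sum_(i < q) a i w ^+ 2).
  by apply: L1_sum => i; exact: (E i).1.
have LE : location_err = fun w => q%:R^-1 * \sum_(i < q) a i w ^+ 2.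
  by apply/funext => w; rewrite /location_err mulrC.
rewrite LE; split; first exact: L1Z.
rewrite meanZ// ler_pdivrMl// mean_sum; last by move=> i; exact: (E i).1.
apply: (@le_trans _ _ (\sum_(i < q) 3208 * dev_bound / n%:R)).
  by apply: ler_sum => i _; exact: (E i).2.
by rewrite sumr_const card_ord -(mulr_natl (3208 * dev_bound / n%:R)).
Qed.

Lemma residual_normE t w :
  norm2 (elliptical_obs mu S (xi t) (z t) w - \col_i muhat i w) ^+ 2 / q%:R =
  (\sum_(i < q) (dev i t w - a i w) ^+ 2) / q%:R.
Proof.
rewrite /norm2 sqr_sqrtr; last by apply: sumr_ge0 => i _; exact: sqr_ge0.
congr (_ / _); apply: eq_bigr => i _; congr (_ ^+ 2).
by rewrite mxE elliptical_obsE !mxE /a; ring.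
Qed.

Variables (H' : R) (Exh : {RV P >-> R}).
Hypothesis H'0 : 0 < H'.
Hypothesis hExh : forall w, \sum_(t < n) huber H'
  (norm2 (elliptical_obs mu S (xi t) (z t) w - \col_i muhat i w) ^+ 2 / q%:R
   - Exh w) = 0.

Let np : 0 < n%:R :> R. Proof. by rewrite ltr0n. Qed.

(** The score is 1-Lipschitz, so replacing the true centre by [muhat] costs at
    most the mean perturbation of the squared norms. *)
Lemma scale_error_le w (M1 V : R) : V = Num.sqrt (location_err w) ->
  \sum_(t < n) energy t w <= n%:R * M1 -> V <= 1 ->
  8 * (2 * M1 + C + 3) <= H' ->
  `|Exh w - Ex2| <= 2 * (`|\sum_(t < n) huber H' (energy t w - Ex2)| / n%:R) +
    2 * (V * (1 + M1) + V ^+ 2).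
Proof.
move=> VE XM V1 HM; have V0 : 0 <= V by rewrite VE sqrtr_ge0.
have H'0' := ltW H'0.
pose W t := (\sum_(i < q) (dev i t w - a i w) ^+ 2) / q%:R.
have WX t : `|W t - energy t w| <= V * (1 + energy t w) + V ^+ 2.
  apply: (@norm2_perturb_le _ _ (fun i => dev i t w) (fun i => a i w)) => //.
  exact: energyE.
have WXs : \sum_(t < n) `|W t - energy t w| <= n%:R * (V * (1 + M1) + V ^+ 2).
  apply: (@le_trans _ _ (\sum_(t < n) (V * (1 + energy t w) + V ^+ 2))).
    by apply: ler_sum => t _; exact: WX.
  rewrite big_split /= -mulr_sumr big_split /= !sumr_const card_ord.
  rewrite -(mulr_natl (V ^+ 2)) [leRHS]mulrDr lerD2r mulrCA ler_wpM2l//.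
  by rewrite mulrDr mulr1 lerD2l.
have root : \sum_(t < n) huber H' (W t - Ex2 - (Exh w - Ex2)) = 0.
  rewrite -[RHS](hExh w); apply: eq_bigr => t _; rewrite residual_normE; congr huber.
  by rewrite opprB addrA subrK.
have M10 : 0 <= M1.
  rewrite -(pmulr_rge0 _ np); apply: le_trans XM.
  by apply: sumr_ge0 => t _; exact: energy_ge0.
have small : \sum_(t < n) `|W t - Ex2| <= n%:R * (H' / 8).
  apply: (@le_trans _ _ (\sum_(t < n) (`|W t - energy t w| + energy t w + (1 + C)))).
    apply: ler_sum => t _.
    have -> : W t - Ex2 = (W t - energy t w) + (energy t w - Ex2) by ring.
    apply: le_trans (ler_normD _ _) _; rewrite -addrA lerD2l.
    apply: le_trans (ler_normB _ _) _.
    by rewrite !ger0_norm ?energy_ge0 ?Ex2_ge0// lerD2l Ex2_le.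
  rewrite 2!big_split /= sumr_const card_ord -(mulr_natl (1 + C)).
  have V2 : V ^+ 2 <= 1 by rewrite expr_le1.
  have VM : V * (1 + M1) <= 1 + M1 by rewrite ler_piMl// addr_ge0.
  apply: (@le_trans _ _ (n%:R * (1 + M1 + 1) + n%:R * M1 + n%:R * (1 + C))).
    rewrite lerD2r; apply: lerD => //; apply: le_trans WXs _.
    by rewrite ler_wpM2l ?(ltW np)//; exact: lerD.
  by rewrite -!mulrDr ler_wpM2l ?(ltW np)//; lra.
have := huber_root_near n0 H'0 root small.
set b := `|Exh w - Ex2|; set s := `|\sum_(t < n) huber H' (W t - Ex2)|.
set g := `|\sum_(t < n) huber H' (energy t w - Ex2)| => nb.
have sg : s <= g + n%:R * (V * (1 + M1) + V ^+ 2).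
  have -> : s = `|\sum_(t < n) huber H' (energy t w - Ex2) + \sum_(t < n)
      (huber H' (W t - Ex2) - huber H' (energy t w - Ex2))|.
    by rewrite -big_split /=; congr `|_|; apply: eq_bigr => t _; ring.
  apply: le_trans (ler_normD _ _) _; rewrite lerD2l.
  apply: le_trans (ler_norm_sum _ _ _) _; apply: le_trans WXs.
  apply: ler_sum => t _; apply: le_trans (huber_lipschitz _ _ H'0') _.
  by rewrite opprB addrA subrK.
rewrite -(ler_pM2l np) mulrDr mulrCA [_ * (g / _)]mulrCA divff ?gt_eqF// mulr1.
by rewrite mulrCA; lra.
Qed.

(** The bound of [scale_error_le] holds off three events: a large mean energy, a
    large location error and a large score at the true centre. Markov's
    inequality bounds the probability of each. *)
Lemma sample_tail (M1 M2 M3 rho G : R) : 0 < M1 -> 0 < M2 -> 0 < M3 ->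
  0 < rho -> M2 <= n%:R -> 16 * (1 + dev_bound) <= H ->
  8 * (2 * M1 + C + 3) <= H' ->
  mean P (fun w => (\sum_(t < n) huber H' (energy t w - Ex2)) ^+ 2) <=
    G * (n%:R * rho) ^+ 2 ->
  (P [set w | (2 * (M3 * rho) + 2 * (Num.sqrt (M2 / n%:R) * (1 + M1) + M2 / n%:R) <
     `|Exh w - Ex2|)%R] <=
   ((1 + C) / M1 + 3208 * dev_bound / M2 + G / M3 ^+ 2)%:E)%E.
Proof.
move=> M10 M20 M30 rho0 M2n HB HM GS.
have [VL Vle] := mean_location_err HB.
have [SL _] := energy_score_mse H'0.
pose X w := \sum_(t < n) energy t w.
have XL : L1 P X by apply: L1_sum => t; exact: (mean_energy t).1.
have X0 w : 0 <= X w by apply: sumr_ge0 => t _; exact: energy_ge0.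
have XM : mean P X = n%:R * Ex2.
  rewrite mean_sum; last by move=> t; exact: (mean_energy t).1.
  rewrite (eq_bigr (fun=> Ex2)); last by move=> t _; exact: (mean_energy t).2.
  by rewrite sumr_const card_ord mulr_natl.
pose Sc w := (\sum_(t < n) huber H' (energy t w - Ex2)) ^+ 2.
pose A1 := [set w | n%:R * M1 < X w].
pose A2 := [set w | M2 / n%:R < location_err w].
pose A3 := [set w | (n%:R * (M3 * rho)) ^+ 2 < Sc w].
have mgt (f : T -> R) c : L1 P f -> measurable [set w | c < f w].
  move=> fL; rewrite -[X in measurable X]setTI.
  by apply: measurable_fun_ltr => //; exact: L1_measurable fL.
have [m1 m2 m3] : [/\ measurable A1, measurable A2 & measurable A3].
  by split; exact: mgt.
have nM1 : 0 < n%:R * M1 by exact: mulr_gt0.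
have nM2 : 0 < M2 / n%:R by exact: divr_gt0.
have nM3 : 0 < (n%:R * (M3 * rho)) ^+ 2 by rewrite exprn_gt0// !mulr_gt0.
have P1 : (P A1 <= ((1 + C) / M1)%:E)%E.
  apply: (le_trans (markov_L1 nM1 X0 XL)); rewrite lee_fin XM.
  by rewrite -mulf_div divff ?gt_eqF// mul1r ler_wpM2r ?invr_ge0 ?(ltW M10)// Ex2_le.
have P2 : (P A2 <= (3208 * dev_bound / M2)%:E)%E.
  apply: (le_trans (markov_L1 nM2 location_err_ge0 VL)); rewrite lee_fin.
  rewrite ler_pdivrMr// mulrA divfK ?gt_eqF//.
have P3 : (P A3 <= (G / M3 ^+ 2)%:E)%E.
  apply: (le_trans (markov_L1 nM3 (fun w => sqr_ge0 _) SL)); rewrite lee_fin.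
  rewrite ler_pdivrMr//; apply: le_trans GS _.
  rewrite le_eqVlt; apply/orP; left; apply/eqP; field.
  by rewrite gt_eqF.
rewrite 2!EFinD; apply: le_trans (leeD (leeD P1 P2) P3).
apply: (@le_trans _ _ (P (A1 `|` A2 `|` A3))); last first.
  apply: le_trans (measureU2 _ _ _) _ => //; first exact: measurableU.
  by rewrite leeD2r//; exact: measureU2.
apply: le_measure; rewrite ?inE; [| |].
- rewrite -[X in measurable X]setTI; apply: measurable_fun_ltr => //.
  by apply: measurableT_comp => //; apply: measurable_funB => //; exact: measurable_funPT.
- by apply: measurableU => //; exact: measurableU.
move=> w /= big; apply: contrapT => /not_orP[/not_orP[n1 n2] n3].
move: big; apply/negP; rewrite -leNgt.
have {}n1 : X w <= n%:R * M1 by rewrite leNgt; exact/negP.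
have {}n2 : location_err w <= M2 / n%:R by rewrite leNgt; exact/negP.
have {}n3 : Sc w <= (n%:R * (M3 * rho)) ^+ 2 by rewrite leNgt; exact/negP.
set V := Num.sqrt (M2 / n%:R).
have Vw : Num.sqrt (location_err w) <= V by rewrite ler_sqrt// ltW.
have V1 : V <= 1.
  by rewrite -[leRHS]sqrtr1 ler_sqrt// ler_pdivrMr// mul1r.
have V2 : M2 / n%:R = V ^+ 2 by rewrite sqr_sqrtr// ltW.
apply: le_trans (scale_error_le erefl n1 (le_trans Vw V1) HM) _.
have w0 := sqrtr_ge0 (location_err w).
apply: lerD; rewrite ler_wpM2l//; last first.
  rewrite V2; apply: lerD; first by rewrite ler_wpM2r// addr_ge0// ltW.
  by apply: lerXn2r; rewrite ?nnegrE ?sqrtr_ge0.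
rewrite ler_pdivrMr// mulrC.
rewrite -ler_sqr ?nnegrE ?mulr_ge0 ?(ltW np) ?(ltW M30) ?(ltW rho0)//.
by rewrite real_normK ?num_real.
Qed.

End Sample.

(** * Rates *)

Lemma bigTheta_bounds {R : realType} (f g : nat -> R) :
  f =Theta_\oo g -> (forall n, 0 <= g n) ->
  exists k1 k2 : R, [/\ 0 < k1, 0 < k2 & \forall n \near \oo,
    k1 * g n <= `|f n| /\ `|f n| <= k2 * g n].
Proof.
rewrite eqThetaE qualifE => /asboolP[[k1 k2] /= /andP[k10 k20] kP] g0.
exists k1, k2; split=> //; apply: filterS kP => n.
by rewrite (ger0_norm (g0 n)).
Qed.

(** [1 / n ^ (eps / (2 + eps))]: the rate at which the bias and the standard
    deviation of the truncated mean balance. *)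
Lemma score_rate {R : realType} (eps k1 k2 m H : R) (n : nat) :
  0 < eps < 2 -> 0 < k1 -> 0 < k2 -> 0 <= m -> (0 < n)%N -> 0 < H ->
  k1 * n%:R `^ (1 / (1 + eps / 2)) <= H ->
  H <= k2 * n%:R `^ (1 / (1 + eps / 2)) ->
  2 * (n%:R * (m * H `^ (2 - (1 + eps / 2)))) +
  2 * (n%:R * (m * H `^ (1 - (1 + eps / 2)))) ^+ 2 <=
  (2 * (m * k2 `^ (2 - (1 + eps / 2))) +
   2 * (m * k1 `^ (1 - (1 + eps / 2))) ^+ 2) *
  (n%:R * (1 / n%:R `^ (eps / (2 + eps)))) ^+ 2.
Proof.
move=> /andP[e0 e2] k10 k20 m0 n0 H0 Hl Hu.
have np : 0 < n%:R :> R by rewrite ltr0n.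
set r := 1 + eps / 2 in Hl Hu *; set N := n%:R in np Hl Hu *.
have r1 : 1 < r by rewrite /r; lra.
have r0 : r != 0 by rewrite gt_eqF// (lt_trans ltr01).
have e20 : 2 + eps != 0 by rewrite gt_eqF//; lra.
have Nr : N * (1 / N `^ (eps / (2 + eps))) = N `^ (1 - eps / (2 + eps)).
  rewrite powRB; last by rewrite (gt_eqF np) implybT.
  by rewrite powRr1 ?(ltW np)// div1r.
rewrite Nr [leRHS]mulrDl; apply: lerD.
  rewrite -!mulrA ler_wpM2l// mulrCA ler_wpM2l//.
  apply: (@le_trans _ _ (N * ((k2 * N `^ (1 / r)) `^ (2 - r)))).
    rewrite ler_wpM2l ?(ltW np)//; apply: ge0_ler_powR => //.
    - by rewrite /r; lra.
    - by rewrite nnegrE ltW.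
    - by rewrite nnegrE mulr_ge0 ?powR_ge0// ltW.
  rewrite powRM ?powR_ge0 ?(ltW k20)// mulrCA ler_wpM2l ?powR_ge0//.
  rewrite -powRrM -[X in X * _]powRr1 ?(ltW np)// -powRD; last first.
    by rewrite (gt_eqF np) implybT.
  rewrite -[leRHS]powR_mulrn ?powR_ge0// -powRrM.
  rewrite le_eqVlt; apply/orP; left; apply/eqP; congr powR.
  by rewrite /r; field; rewrite e20 /=; lra.
rewrite -mulrA ler_wpM2l// -exprMn; apply: lerXn2r.
- by rewrite nnegrE !mulr_ge0 ?powR_ge0// ltW.
- by rewrite nnegrE !mulr_ge0 ?powR_ge0// ltW.
rewrite mulrCA -mulrA ler_wpM2l//.
apply: (@le_trans _ _ (N * ((k1 * N `^ (1 / r)) `^ (1 - r)))).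
  rewrite ler_wpM2l ?(ltW np)// -(opprB r 1) !powRN.
  have kN : 0 < k1 * N `^ (1 / r) by rewrite mulr_gt0// powR_gt0.
  rewrite lef_pV2 ?posrE ?powR_gt0//; apply: ge0_ler_powR => //.
  - lra.
  - by rewrite nnegrE ltW.
  - by rewrite nnegrE ltW.
rewrite powRM ?powR_ge0 ?(ltW k10)// mulrCA ler_wpM2l ?powR_ge0//.
rewrite -powRrM -[X in X * _]powRr1 ?(ltW np)// -powRD; last first.
  by rewrite (gt_eqF np) implybT.
rewrite le_eqVlt; apply/orP; left; apply/eqP; congr powR.
by rewrite /r; field; rewrite e20 /=; lra.
Qed.

Lemma rate_sqrt_le {R : realType} (eps : R) (n : nat) : 0 < eps < 2 ->
  (0 < n)%N -> (Num.sqrt n%:R)^-1 <= 1 / n%:R `^ (eps / (2 + eps)).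
Proof.
move=> /andP[e0 e2] n0; have np : 0 < n%:R :> R by rewrite ltr0n.
rewrite div1r lef_pV2 ?posrE ?powR_gt0 ?sqrtr_gt0// -powR12_sqrt//.
apply: ler_powR; first by rewrite ler1n.
by rewrite ler_pdivrMr; lra.
Qed.

Theorem proposition2 (R : realType) (d : nat -> measure_display)
    (T : forall n : nat, measurableType (d n))
    (P : forall n : nat, probability (T n) R)
    (p : nat -> nat) (hp : forall n, (0 < p n)%N)
    (mu : forall n, 'cV[R]_(p n))
    (Sigma S : forall n, 'M[R]_(p n))
    (hSigma : forall n, psd (Sigma n))
    (hS : forall n, psd_sqrt_of (Sigma n) (S n))
    (htr : forall n, \tr (Sigma n) = (p n)%:R)
    (xi : forall n : nat, 'I_n -> {RV (P n) >-> R})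
    (hxi : forall n (t : 'I_n) w, 0 <= xi n t w)
    (z : forall n : nat, 'I_n -> 'I_(p n) -> {RV (P n) >-> R})
    (hz : forall n, iid_standard_gaussian_vectors (z n))
    (* Exi2 n is the common second moment of the xi n t *)
    (Exi2 : nat -> R)
    (hExi2 : forall n (t : 'I_n),
       ('E_(P n)[(fun w => xi n t w ^+ 2)%R] = (Exi2 n)%:E)%E)
    (eps : R) (heps : 0 < eps < 2)
    (A1 : assumption1 eps xi (fun n t => direction (z n t)))
    (A2 : assumption2 Sigma)
    (lam : forall n, 'I_(p n) -> R)
    (hlam : forall n, ordered_eigenvalues (Sigma n) (lam n))
    (A3 : assumption3 lam)
    (* H = O(sqrt(n / log p)), multiplied out so that p = 1 is not excluded
       by the convention x / 0 = 0 *)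
    (H H' : nat -> R)
    (hHoo : H @ \oo --> +oo)
    (hHO : (fun n => H n * Num.sqrt (ln (p n)%:R)) =O_\oo
           (fun n : nat => Num.sqrt n%:R))
    (hH' : H' =Theta_\oo (fun n : nat => n%:R `^ (1 / (1 + eps / 2))))
    (muhat : forall n, 'I_(p n) -> {RV (P n) >-> R})
    (hmuhat : forall n (i : 'I_(p n)) w,
       \sum_(t < n) huber (H n)
         (elliptical_obs (mu n) (S n) (xi n t) (z n t) w i ord0
          - muhat n i w) = 0)
    (Exi2hat : forall n, {RV (P n) >-> R})
    (hExi2hat : forall n w,
       \sum_(t < n) huber (H' n)
         (norm2 (elliptical_obs (mu n) (S n) (xi n t) (z n t) w
                 - \col_i muhat n i w) ^+ 2 / (p n)%:R
          - Exi2hat n w) = 0)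
    (hlogp : (fun n => ln (p n)%:R) =O_\oo (fun n : nat => n%:R : R)) :
  bigO_p P (fun n w => `|Exi2hat n w - Exi2 n|)
    (fun n => 1 / n%:R `^ (eps / (2 + eps)) + Num.sqrt (ln (p n)%:R / n%:R)).
Proof.
have [xi_ind xi_id xi_u [c [C [/andP[c0 cC] xiC]]]] := A1.
have [c' [Cs [/andP[c'0 c'Cs] SigC]]] := A2.
have C0 : 0 < C by exact: lt_trans cC.
have Cs0 : 0 < Cs by exact: lt_trans c'Cs.
move=> eta eta0.
have [k1 [k2 [k10 k20 kH']]] := bigTheta_bounds hH' (fun n => powR_ge0 _ _).
set r := 1 + eps / 2 in kH'.
have B0 : 0 < dev_bound C Cs by rewrite mulr_gt0// addr_gt0.
have m0 : 0 <= energy_moment C.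
  rewrite addr_ge0 ?sqr_ge0// mulr_ge0 ?(ltW C0)// addr_ge0// mulr_ge0//.
  by rewrite /sphere_c4 divr_ge0 ?sqr_ge0// mulr_ge0// normal_m4_ge0.
pose G := 2 * (energy_moment C * k2 `^ (2 - r)) +
  2 * (energy_moment C * k1 `^ (1 - r)) ^+ 2.
have G0 : 0 <= G by rewrite addr_ge0// mulr_ge0 ?sqr_ge0// mulr_ge0// powR_ge0.
have [K KE K0] : exists2 K : R, K = 3208 * dev_bound C Cs & 0 < K.
  exists (3208 * dev_bound C Cs); first reflexivity.
  by apply: mulr_gt0; [rewrite ltr0n|exact: B0].
(* Each of the three terms of [sample_tail] becomes at most [eta / 3]. *)
pose M1 := 3 * (1 + C) / eta; pose M2 := 3 * K / eta.
pose M3 := 1 + 3 * G / eta.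
have M10 : 0 < M1 by rewrite divr_gt0// mulr_gt0// addr_gt0.
have M20 : 0 < M2 by rewrite divr_gt0// mulr_gt0.
have G1 : 0 <= 3 * G / eta by rewrite divr_ge0 ?(ltW eta0)// mulr_ge0.
have M30 : 0 < M3 by rewrite ltr_pwDl.
pose M := 2 * M3 + 2 * (Num.sqrt M2 * (1 + M1) + M2).
have M0 : 0 < M.
  by rewrite addr_gt0// mulr_gt0// addr_gt0// mulr_gt0 ?sqrtr_gt0// addr_gt0.
exists M => //.
pose a := 1 / (1 + eps / 2).
have a0 : 0 < a by have /andP[e0 _] := heps; rewrite divr_gt0//; lra.
pose L := 8 * (2 * M1 + C + 3).
have L0 : 0 < L by rewrite /L; have := M10; lra.
have nearH : \forall n \near \oo, 16 * (1 + dev_bound C Cs) <= H n.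
  by move/cvgryPge : hHoo; exact.
near=> n.
have n0 : (0 < n)%N by near: n; exact: nbhs_infty_gt.
have np : 0 < n%:R :> R by rewrite ltr0n.
have M2n : M2 <= n%:R by near: n; exact: nbhs_infty_ger.
have HB : 16 * (1 + dev_bound C Cs) <= H n by near: n; exact: nearH.
have [H'l H'u] : k1 * n%:R `^ a <= `|H' n| /\ `|H' n| <= k2 * n%:R `^ a.
  by near: n; exact: kH'.
have Ln : (L / k1) `^ a^-1 <= n%:R by near: n; exact: nbhs_infty_ger.
have HL : L <= `|H' n|.
  apply: le_trans H'l; rewrite -ler_pdivrMl// mulrC.
  have -> : L / k1 = ((L / k1) `^ a^-1) `^ a.
    by rewrite -powRrM mulVf ?gt_eqF// powRr1// divr_ge0 ?(ltW L0) ?(ltW k10).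
  by apply: ge0_ler_powR; rewrite ?nnegrE ?(ltW a0) ?powR_ge0.
have H'n0 : 0 < `|H' n| by exact: lt_le_trans HL.
(* The score for a negative [H' n] is constant and cannot vanish. *)
have H'0 : 0 < H' n.
  rewrite ltNge; apply/negP => H'neg.
  have hub x : huber (H' n) x = H' n.
    by rewrite /huber min_l// le_max; apply/orP; left; lra.
  have := hExi2hat n point; under eq_bigr do rewrite hub.
  rewrite sumr_const card_ord => /eqP; rewrite mulrn_eq0 eqn0Ngt n0 /= => /eqP H'n.
  by move: H'n0; rewrite H'n normr0 ltxx.
rewrite (gtr0_norm H'0) in H'l H'u HL.
pose rho := 1 / n%:R `^ (eps / (2 + eps)) : R.
have rho0 : 0 < rho by rewrite divr_gt0// powR_gt0.
have xiE t := (xiC n t).1.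
have SigC' i : Sigma n i i <= Cs by have /andP[_ /ltW] := SigC n i.
have [_ Sle] := energy_score_mse n0 (hp n) (hS n) (htr n) (hxi n) (hz n)
  (xi_ind n) (xi_u n) (hExi2 n) heps xiE H'0.
have GS := le_trans Sle (score_rate heps k10 k20 m0 n0 H'0 H'l H'u).
have tail := sample_tail n0 (hp n) (hS n) (htr n) (hxi n) (hz n) (xi_ind n)
  (xi_u n) (hExi2 n) heps xiE SigC' (hmuhat n) H'0 (hExi2hat n)
  M10 M20 M30 rho0 M2n HB HL GS.
apply: (@le_trans _ _ (P n [set w | (2 * (M3 * rho) + 2 * (Num.sqrt (M2 / n%:R) *
    (1 + M1) + M2 / n%:R) < `|Exi2hat n w - Exi2 n|)%R])).
  have mE : measurable_fun setT (fun w => `|Exi2hat n w - Exi2 n|).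
    by apply: measurableT_comp => //; apply: measurable_funB.
  apply: le_measure; rewrite ?inE.
  - rewrite -[X in measurable X]setTI; apply: measurable_fun_ltr => //.
    exact: measurableT_comp.
  - by rewrite -[X in measurable X]setTI; exact: measurable_fun_ltr.
  move=> w /=; rewrite normr_id; apply: le_lt_trans.
  apply: (@le_trans _ _ (M * rho)); last first.
    by rewrite ler_wpM2l ?(ltW M0)// lerDl sqrtr_ge0.
  have nr : (Num.sqrt n%:R)^-1 <= rho by exact: rate_sqrt_le.
  have nr' : n%:R^-1 <= rho.
    apply: le_trans nr; rewrite lef_pV2 ?posrE ?sqrtr_gt0//.
    rewrite -[leRHS]sqr_sqrtr// expr2 ler_peMr ?sqrtr_ge0//.
    by rewrite -[leLHS]sqrtr1 ler_sqrt ?ler1n.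
  rewrite /M [leRHS]mulrDl -!(mulrA 2) lerD2l ler_wpM2l// [leRHS]mulrDl; apply: lerD.
    rewrite sqrtrM ?(ltW M20)// sqrtrV// -!mulrA ler_wpM2l ?sqrtr_ge0//.
    by rewrite mulrC ler_wpM2l// addr_ge0// ltW.
  by rewrite ler_wpM2l// ltW.
apply: (le_trans tail); rewrite lee_fin -KE.
have -> : (1 + C) / M1 = eta / 3.
  by rewrite /M1; field; rewrite !gt_eqF// addr_gt0.
have -> : K / M2 = eta / 3.
  by rewrite /M2; field; rewrite !gt_eqF.
have : G / M3 ^+ 2 <= eta / 3.
  rewrite ler_pdivrMr ?exprn_gt0//.
  have GE : G = 3 * G / eta * (eta / 3) by field; rewrite gt_eqF.
  rewrite {1}GE mulrC ler_wpM2l ?divr_ge0 ?(ltW eta0)//.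
  rewrite /M3; move: G1; generalize (3 * G / eta) => g g0.
  by rewrite sqrrD expr1n mul1r; have := sqr_ge0 g; lra.
move=> h; apply: (le_trans (lerD (lexx _) h)); lra.
Unshelve. all: by end_near.
Qed.
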